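(* Let $1\le k\le n-1$, $f(y)=f_0(y_n)$, $y\in\mathbb R^n_+$, so that $(Jf)(x,\xi)=\Phi(x_n)$, and let $$F(t)=\frac{\pi^{1/2}}{\Gamma((k+1)/2)}\left(\frac t2\right)^{k-1}\Phi(t/2).$$ If $$\int_0^a|f_0(s)|\,s^{(k-2)/2}\,ds<\infty\quad\text{for every }a>0,$$ then $f_0(s)$ can be reconstructed for almost all $s>0$ by the formula $$f_0(s)=s^{(2-k)/2}\,(\mathcal D^{k/2}_{0+}F)(s).$$ If, moreover, $a>0$ and $(Jf)(x,\xi)=0$ for all $0<x_n<a$, then $f(y)=0$ for all $y_n<a$.
   Context: $\mathbb R^n_+=\{x=(x',x_n):x'\in\mathbb R^{n-1},x_n>0\}$, $e_n=(0,\dots,0,1)$; $G_k(\mathbb R^{n-1})$ is the Grassmannian of $k$-dimensional linear subspaces of $\mathbb R^{n-1}$; $\sigma_k=2\pi^{(k+1)/2}/\Gamma((k+1)/2)$. For $x\in\mathbb R^n_+$, $\xi\in G_k(\mathbb R^{n-1})$, $$(Jf)(x,\xi)=\frac1{\sigma_k}\int_{\mathbb S^k_\xi}f(x+x_n\theta)\,d\theta,\qquad \mathbb S^k_\xi=\mathbb S^{n-1}\cap(\xi\oplus\mathbb R e_n),$$ with $d\theta$ the surface area measure. For $f(y)=f_0(y_n)$ this depends only on $x_n$. Left-sided Riemann–Liouville operators: $(I^\alpha_{0+}\varphi)(x)=\frac1{\Gamma(\alpha)}\int_0^x\varphi(y)(x-y)^{\alpha-1}dy$ for $\alpha>0$;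 writing $\alpha=m+\alpha_0$, $m=[\alpha]$ the integer part, $0\le\alpha_0<1$, $(\mathcal D^\alpha_{0+}\varphi)(x)=(d/dx)^{m+1}(I^{1-\alpha_0}_{0+}\varphi)(x)$.
   Formalization: The final claim ''f(y)=0 for all y_n<a'' is proved for almost every height y_n in (0,a); literally it fails, e.g. when f_0 is the indicator of the single point 1 and a=2, where Jf vanishes identically. *)

(* Defs.v *)
From HB Require Import structures.
From mathcomp Require Import all_boot all_order all_algebra.
From mathcomp Require Import all_classical all_reals all_analysis.
From mathcomp Require Import measurable_realfun.

Set Implicit Arguments.
Unset Strict Implicit.
Unset Printing Implicit Defensive.

Import Order.TTheory GRing.Theory Num.Theory.
Import numFieldNormedType.Exports.

Local Open Scope classical_set_scope.
Local Open Scope ring_scope.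

Definition Gamma {R : realType} (a : R) : R :=
  \int[lebesgue_measure]_(y in `]0, +oo[) (y `^ (a - 1) * expR (- y)).

Definition sigma (R : realType) (k : nat) : R :=
  2 * pi `^ (k.+1%:R / 2) / Gamma (k.+1%:R / 2).

(* The Lebesgue sigma-algebra of the line (the library's `measurable` sets of
   R are the Borel sets).  The library defines the integral of f as the
   supremum of the integrals of the Borel simple functions below f^+, minus the
   same for f^-; for f Lebesgue measurable this is the usual Lebesgue integral,
   although `lebesgue_measure` is a measure on the Borel sets. *)
Definition lebesgue_measurable {R : realType} (A : set R) : Prop :=
  completed_algebra_gen (@lebesgue_measure R) A.

Definition lebesgue_measurable_fun {R : realType} (D : set R) (f : R -> R) :=
  forall B : set R, measurable B -> lebesgue_measurable (D `&` f @^-1` B).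

(* R with the sigma-algebra on which `lebesgue_measure` is defined. *)
Local Notation mR R := (measurableTypeR R).

Definition tcons {R : realType} k (p : mR R * k.-tuple (mR R)) :
    k.+1.-tuple (mR R) :=
  [tuple of p.1 :: p.2].

(* Lebesgue measure on the Borel sets of R^k, as an iterated product. *)
Fixpoint lebesgue_tuple {R : realType} (k : nat) :
    set (k.-tuple (mR R)) -> \bar R :=
  match k with
  | 0 => \d_([tuple] : 0.-tuple (mR R))
  | k'.+1 => pushforward (lebesgue_measure \x lebesgue_tuple (k := k'))%E
               (@tcons R k')
  end.

Section lebesgue_tuple_measure.
Context {R : realType}.

Lemma measurable_tcons k : measurable_fun setT (@tcons R k).
Proof. exact: (measurable_cons (f := fst) (g := snd)). Qed.

Section step.
Variables (k : nat) (m : {sigma_finite_measure set (k.-tuple (mR R)) -> \bar R}).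

Let mf := @measurable_tcons k.

Let step := pushforward (lebesgue_measure \x m)%E (@tcons R k).

Let step0 : step set0 = 0%E. Proof. exact: measure0. Qed.

Let step_ge0 A : (0 <= step A)%E. Proof. exact: measure_ge0. Qed.

Let step_sigma_additive : semi_sigma_additive step.
Proof. exact: measure_semi_sigma_additive. Qed.

HB.instance Definition _ := isMeasure.Build _ _ _ step
  step0 step_ge0 step_sigma_additive.

Let uncons (t : k.+1.-tuple (mR R)) := (thead t, [tuple of behead t]).

Let measurable_uncons : measurable_fun setT uncons.
Proof.
apply/measurable_fun_pair => /=; last exact: measurable_behead.
exact: (measurable_tnth ord0).
Qed.

Let step_sigma_finite : sigma_finite setT step.
Proof.
have /sigma_finiteP[F [TF ndF Foo]] := sigma_finiteT (@lebesgue_measure R).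
have /sigma_finiteP[G [TG ndG Goo]] := sigma_finiteT m.
exists (fun i => uncons @^-1` (F i `*` G i)).
  apply/esym/seteqP; split=> // t _.
  have [i _ Ft] : (\bigcup_i F i) (thead t) by rewrite -TF.
  have [j _ Gt] : (\bigcup_i G i) [tuple of behead t] by rewrite -TG.
  exists (maxn i j) => //; split=> /=.
  - by move: Ft; apply/subsetPset/ndF/leq_maxl.
  - by move: Gt; apply/subsetPset/ndG/leq_maxr.
move=> i; have [mF Foo_] := Foo i; have [mG Goo_] := Goo i; split.
  rewrite -[X in measurable X]setTI.
  by apply: measurable_uncons => //; exact: measurableX.
rewrite /step /pushforward (_ : _ @^-1` _ = F i `*` G i).
  by rewrite product_measure1E// lte_mul_pinfty// ge0_fin_numE.
have unconsK p : uncons (tcons p) = p.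
  by case: p => x t; congr pair; exact: val_inj.
by rewrite -comp_preimage (_ : uncons \o _ = id)//; exact/funext.
Qed.

HB.instance Definition _ :=
  Measure_isSigmaFinite.Build _ _ _ step step_sigma_finite.

Definition lebesgue_tuple_step :
  {sigma_finite_measure set (k.+1.-tuple (mR R)) -> \bar R} := step.

End step.

Lemma lebesgue_tuple_bundle k :
  exists m : {sigma_finite_measure set (k.-tuple (mR R)) -> \bar R},
    (m : set (k.-tuple (mR R)) -> \bar R) = @lebesgue_tuple R k.
Proof.
elim: k => [|k [m mE]]; first by exists (\d_([tuple] : 0.-tuple (mR R))).
by exists (lebesgue_tuple_step m); rewrite /= -mE.
Qed.

Section instances.
Variable k : nat.
Let mu := @lebesgue_tuple R k.

Let mu0 : mu set0 = 0%E.
Proof. by have [m mE] := lebesgue_tuple_bundle k; rewrite /mu -mE. Qed.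

Let mu_ge0 A : (0 <= mu A)%E.
Proof. by have [m mE] := lebesgue_tuple_bundle k; rewrite /mu -mE. Qed.

Let mu_sigma_additive : semi_sigma_additive mu.
Proof.
have [m mE] := lebesgue_tuple_bundle k; rewrite /mu -mE.
exact: measure_semi_sigma_additive.
Qed.

HB.instance Definition _ := isMeasure.Build _ _ _ (@lebesgue_tuple R k)
  mu0 mu_ge0 mu_sigma_additive.

Let mu_sigma_finite : sigma_finite setT (@lebesgue_tuple R k).
Proof.
by have [m mE] := lebesgue_tuple_bundle k; rewrite -mE; exact: sigma_finiteT.
Qed.

HB.instance Definition _ :=
  Measure_isSigmaFinite.Build _ _ _ (@lebesgue_tuple R k) mu_sigma_finite.

End instances.
End lebesgue_tuple_measure.

(* The Euclidean norm; the library's norm on vectors is the sup norm. *)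
Definition enorm {R : realType} k (y : k.-tuple (mR R)) : R :=
  Num.sqrt (\sum_(i < k) tnth y i ^+ 2).

Definition radial_proj {R : realType} k (y : k.-tuple (mR R)) : k.-tuple (mR R) :=
  [tuple (enorm y)^-1 * tnth y i | i < k].

Definition punctured_ball (R : realType) (k : nat) : set (k.-tuple (mR R)) :=
  [set y | 0 < enorm y <= 1].
Arguments punctured_ball : clear implicits.

Definition unit_sphere (R : realType) (k : nat) : set (k.+1.-tuple (mR R)) :=
  [set theta | enorm theta = 1].
Arguments unit_sphere : clear implicits.

(* Surface area measure of the unit sphere S^k of R^(k+1): by integration in
   polar coordinates, the area of E is k+1 times the volume of the cone
   {r theta : 0 < r <= 1, theta in E}. *)
Definition sphere_measure {R : realType} k (E : set (k.+1.-tuple (mR R))) : \bar R :=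
  (k.+1%:R%:E * lebesgue_tuple
     (punctured_ball R k.+1 `&` @radial_proj R k.+1 @^-1` E))%E.

Section sphere_measure_instance.
Context {R : realType}.

Lemma measurable_enorm k : measurable_fun setT (@enorm R k).
Proof.
apply: measurableT_comp.
  by apply: continuous_measurable_fun; exact: sqrt_continuous.
by apply: measurable_sum => i; apply: measurable_funX; exact: measurable_tnth.
Qed.

Lemma measurable_punctured_ball k : measurable (punctured_ball R k).
Proof.
rewrite (_ : punctured_ball R k = setT `&` @enorm R k @^-1` `]0, 1]).
  exact: measurable_enorm.
by rewrite setTI; apply/seteqP; split=> y /=; rewrite in_itv.
Qed.

Lemma measurable_radial_proj k : measurable_fun setT (@radial_proj R k).
Proof.
apply/measurable_fun_tnthP => i.
rewrite (_ : _ \o _ = fun y => enorm y `^ (-1) * tnth y i); last first.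
  by apply/funext => y /=; rewrite tnth_mktuple powR_inv1// sqrtr_ge0.
apply: measurable_funM; last exact: measurable_tnth.
by apply: (measurableT_comp (measurable_powR _)); exact: measurable_enorm.
Qed.

Section instance.
Variable k : nat.
Let mu := @sphere_measure R k.
Let nu := pushforward
  (mrestr (@lebesgue_tuple R k.+1) (@measurable_punctured_ball k.+1))
  (@radial_proj R k.+1).

Let mf := @measurable_radial_proj k.+1.

Let nu0 : nu set0 = 0%E. Proof. exact: measure0. Qed.
Let nu_ge0 A : (0 <= nu A)%E. Proof. exact: measure_ge0. Qed.
Let nu_sigma_additive : semi_sigma_additive nu.
Proof. exact: measure_semi_sigma_additive. Qed.

HB.instance Definition _ := isMeasure.Build _ _ _ nu
  nu0 nu_ge0 nu_sigma_additive.

Let muE : mu = mscale k.+1%:R%:nng (nu : {measure set _ -> \bar R}).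
Proof. by apply/funext => E; rewrite /mu /sphere_measure setIC. Qed.

Let mu0 : mu set0 = 0%E. Proof. by rewrite muE measure0. Qed.

Let mu_ge0 A : (0 <= mu A)%E.
Proof. by rewrite muE measure_ge0. Qed.

Let mu_sigma_additive : semi_sigma_additive mu.
Proof.
by rewrite muE; exact: measure_semi_sigma_additive.
Qed.

HB.instance Definition _ := isMeasure.Build _ _ _ (@sphere_measure R k)
  mu0 mu_ge0 mu_sigma_additive.

End instance.
End sphere_measure_instance.

(* R^n with n = d + 1 is 'rV_(d + 1), its points being the (x', x_n), with x'
   in R^d; G_k(R^d) is the set of the xi : {vspace 'rV_d} with \dim xi = k. *)
Definition height {R : realType} d (x : 'rV[R]_(d + 1)) : R := rsubmx x 0 0.

Definition half_space (R : realType) d : set 'rV[R]_(d + 1) :=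
  [set x | 0 < height x].
Arguments half_space : clear implicits.

Definition grassmannian (R : realType) (k d : nat) : set {vspace 'rV[R]_d} :=
  [set xi | \dim xi = k].
Arguments grassmannian : clear implicits.

(* The rows of B form an orthonormal basis of xi. *)
Definition orthonormal_frame {R : realType} k d (xi : {vspace 'rV[R]_d})
    (B : 'M[R]_(k, d)) : Prop :=
  B *m B^T = 1%:M /\ forall v : 'rV[R]_d, (v \in xi) = (v <= B)%MS.

Definition frame {R : realType} k d (xi : {vspace 'rV[R]_d}) : 'M[R]_(k, d) :=
  xget 0 [set B | orthonormal_frame xi B].

Lemma gram_schmidt {R : realType} k d (A : 'M[R]_(k, d)) : row_free A ->
  exists2 B : 'M[R]_(k, d), B *m B^T = 1%:M & (B :=: A)%MS.
Proof.
elim: k A => [|k IH] A fA.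
  by exists 0; [apply/matrixP => -[]|apply/eqmxP; rewrite !flatmx0 submx_refl].
suff step (C : 'M[R]_(1 + k, d)) : row_free C ->
    exists2 B : 'M[R]_(1 + k, d), B *m B^T = 1%:M & (B :=: C)%MS by exact: step.
move=> {A fA} fA; rewrite -(vsubmxK C) in fA *.
set u := usubmx _ in fA *; set A' := dsubmx _ in fA *.
have fA' : row_free A'.
  apply/inj_row_free => v vA'; have := mulmx_free_eq0 (row_mx 0 v) fA.
  rewrite mul_row_col mul0mx vA' add0r eqxx => /esym.
  by rewrite row_mx_eq0 => /andP[_ /eqP].
have [B BB BA] := IH A' fA'.
pose w := u - u *m B^T *m B.
have wB : w *m B^T = 0 by rewrite mulmxBl -!mulmxA BB mulmx1 subrr.
have w0 : w != 0.
  apply/eqP => /eqP; rewrite subr_eq0 => /eqP uE.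
  have /submxP[D uD] : (u <= A')%MS by rewrite -BA uE submxMl.
  have := mulmx_free_eq0 (row_mx 1%:M (- D)) fA.
  rewrite mul_row_col mul1mx mulNmx -uD subrr eqxx => /esym.
  rewrite row_mx_eq0 => /andP[/eqP/matrixP/(_ 0 0)]; rewrite !mxE => /eqP.
  by rewrite oner_eq0.
pose c := (w *m w^T) 0 0.
have cE : c = \sum_j w 0 j ^+ 2.
  by rewrite /c mxE; apply: eq_bigr => j _; rewrite [w^T _ _]mxE expr2.
have c0 : 0 < c.
  rewrite lt_neqAle {2}cE sumr_ge0 ?andbT; last by move=> *; exact: sqr_ge0.
  apply: contra w0 => /eqP/esym; rewrite cE => /psumr_eq0P c0.
  apply/eqP/rowP => j; apply/eqP; rewrite [X in _ == X]mxE -sqrf_eq0 c0// => *.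
  exact: sqr_ge0.
pose r := (Num.sqrt c)^-1.
have r0 : r != 0 by rewrite invr_eq0 sqrtr_eq0 -ltNge.
have wwE : w *m w^T = c%:M by rewrite [LHS]mx11_scalar.
exists (col_mx (r *: w) B : 'M[R]_(1 + k, d)).
  rewrite tr_col_mx mul_col_row [(r *: w)^T]linearZ/= -!scalemxAl -!scalemxAr.
  have Bw : B *m w^T = 0 by rewrite -[LHS]trmxK trmx_mul trmxK wB trmx0.
  rewrite BB wwE wB Bw !scaler0 scalerA scale_scalar_mx -expr2 exprVn.
  by rewrite sqr_sqrtr 1?ltW// mulVf ?gt_eqF// -scalar_mx_block.
apply/eqmxP/andP; split; rewrite col_mx_sub.
  have BC : (B <= col_mx u A')%MS by rewrite BA -addsmxE addsmxSr.
  have uC : (u <= col_mx u A')%MS by rewrite -addsmxE addsmxSl.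
  rewrite BC andbT scalemx_sub// addmx_sub// eqmx_opp.
  exact: submx_trans (submxMl _ _) BC.
have BD : (B <= col_mx (r *: w) B)%MS by rewrite -addsmxE addsmxSr.
rewrite -BA BD andbT -(subrK (u *m B^T *m B) u) addmx_sub//.
  by rewrite -addsmxE (submx_trans _ (addsmxSl _ _))// eqmx_scale.
exact: submx_trans (submxMl _ _) BD.
Qed.

Lemma frameP {R : realType} k d (xi : {vspace 'rV[R]_d}) :
  grassmannian R k d xi -> orthonormal_frame xi (frame k xi).
Proof.
move=> dimxi; apply: (@xgetPex _ 0 [set B : 'M[R]_(k, d) | orthonormal_frame xi B]).
have {dimxi} : \dim xi = k := dimxi; move=> <-.
pose A := \matrix_(i < \dim xi) (vbasis xi)`_i.
have AE (u : 'rV_(\dim xi)) : u *m A = \sum_i u 0 i *: (vbasis xi)`_i.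
  by rewrite mulmx_sum_row; apply: eq_bigr => i _; rewrite rowK.
have fA : row_free A.
  apply/inj_row_free => u; rewrite AE => uA.
  apply/rowP => i; rewrite mxE.
  by have /freeP/(_ (fun i => u 0 i) uA i) := basis_free (vbasisP xi).
have [B BB BA] := gram_schmidt fA; exists B; split=> // v; rewrite BA.
apply/idP/submxP => [vxi|[u ->]].
  exists (\row_i coord (vbasis xi) i v); rewrite AE {1}(coord_vbasis vxi).
  by apply: eq_bigr => i _; rewrite mxE.
rewrite AE; apply: rpred_sum => i _; apply: rpredZ; apply: vbasis_mem.
by rewrite mem_nth// size_tuple.
Qed.

(* The linear isometry of R^(k+1) onto xi + R e_n that sends the first basis
   vector to e_n and the k others to the chosen orthonormal basis of xi. *)
Definition sphere_param {R : realType} k d (xi : {vspace 'rV[R]_d})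
    (theta : k.+1.-tuple (mR R)) : 'rV[R]_(d + 1) :=
  row_mx ((\row_i tnth theta (lift ord0 i)) *m frame k xi) (thead theta)%:M.

(* The isometry `sphere_param` carries the surface measure of S^k to that of
   S^k_xi; the value does not depend on the choice of the orthonormal basis,
   since `sphere_measure` is rotation invariant. *)
Definition J {R : realType} k d (f : 'rV[R]_(d + 1) -> R)
    (x : 'rV[R]_(d + 1)) (xi : {vspace 'rV[R]_d}) : R :=
  (sigma R k)^-1 * \int[@sphere_measure R k]_(theta in unit_sphere R k)
    f (x + height x *: sphere_param xi theta).

Definition RL_integral {R : realType} (alpha : R) (phi : R -> R) (x : R) : R :=
  (Gamma alpha)^-1 *
  \int[lebesgue_measure]_(y in `]0, x[) (phi y * (x - y) `^ (alpha - 1)).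

(* The function of which the left-sided Riemann-Liouville derivative of order
   alpha = m + alpha0 is the (m+1)-st derivative. *)
Definition RL_primitive {R : realType} (alpha : R) (phi : R -> R) : R -> R :=
  RL_integral (1 - (alpha - (Num.truncn alpha)%:R)) phi.

Definition RL_derivative {R : realType} (alpha : R) (phi : R -> R) : R -> R :=
  derive1n (Num.truncn alpha).+1 (RL_primitive alpha phi).

(* `derive1n` is total; this says that the (m+1)-st derivative of g at s exists
   in the classical sense. *)
Definition derivableS_at {R : realType} (m : nat) (g : R -> R) (s : R) : Prop :=
  (forall j, (j < m)%N -> \forall t \near s, derivable (derive1n j g) t 1) /\
  derivable (derive1n m g) s 1.

Definition RL_derivable {R : realType} (alpha : R) (phi : R -> R) (s : R) :=
  derivableS_at (Num.truncn alpha) (RL_primitive alpha phi) s.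

(* Main.v *)
(* Only the height 1 + theta_0 of a point of the sphere matters.  The law of
   theta_0 under the surface measure is found with Gamma and Beta integrals:
   |y|^2 for y in R^k has the density pi^(k/2) u^(k/2-1) / Gamma(k/2), by
   induction on k and the convolution rule for powers, whence theta_0 has a
   density proportional to (1 - t^2)^(k/2-1).  An affine substitution then turns
   F into the fractional integral of order k/2 of phi(s) = f_0(s) s^((k-2)/2).
   By Fubini's theorem and the same convolution rule the fractional integrals
   form a semigroup, so that the function whose derivative of order m+1 defines
   D^(k/2) F is the (m+1)-fold integral of phi; it is differentiated m times by
   the fundamental theorem of calculus, and once more by Lebesgue's
   differentiation theorem.  Injectivity follows since F vanishes on (0, a). *)
Require Import Defs.
From HB Require Import structures.
From mathcomp Require Import all_boot all_order all_algebra.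
From mathcomp Require Import all_classical all_reals all_analysis.
From mathcomp Require Import measurable_realfun ring lra.

Set Implicit Arguments.
Unset Strict Implicit.
Unset Printing Implicit Defensive.

Import Order.TTheory GRing.Theory Num.Theory.
Import numFieldNormedType.Exports.

Local Open Scope classical_set_scope.
Local Open Scope ring_scope.

(** * Integrals over the line *)

(** Two obstacles shape the proof. The function [f0] is only Lebesgue measurable, while the tools
    for substitution and Fubini want Borel functions; it is therefore replaced by a Borel [g] that
    agrees with it off a null set and vanishes on the nonpositive half-line. On the sphere the
    exchange is harmless because theta_0 has a density, hence null sets of latitudes have area 0.
    Secondly, for k = 1 the fractional integral of order k/2 may diverge on a null set, where [fine]
    returns 0. After composition the order is m+1 >= 1, its kernel is bounded on bounded intervals,
    and the composed integral is finite at every point. All Gamma and Beta computations come from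
    one identity: in the variables w = u + r and v = u/(u + r), the product u^(a-1) r^(b-1)
    separates. It gives the relation between Gamma and Beta, the density of |y|^2, and the law of
    theta_0, where the cone over the sphere is a condition on w and the latitude a function of v.
    The argument t/2 in F arises because the heights on a sphere about a point of height h fill
    [0, 2h]: the upper limit t of the fractional integral is 2h. *)

Section null_modification.
Local Open Scope ereal_scope.
Context d (T : measurableType d) (R : realType).
Variable mu : {measure set T -> \bar R}.
Import HBNNSimple.

(** A simple function below [f], cut off to 0 on [N], keeps its integral and then lies below [g]
    everywhere, since [g] is nonnegative on [N]. *)
Lemma ge0_le_integral_off_null (N : set T) (f g : T -> \bar R) :
  measurable N -> mu N = 0 -> (forall x, 0 <= f x) -> (forall x, 0 <= g x) ->
  (forall x, ~ N x -> f x <= g x) ->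
  \int[mu]_x f x <= \int[mu]_x g x.
Proof.
move=> mN N0 f0 g0 fg; rewrite !ge0_integralTE//.
apply: ge_ereal_sup => _ [h hf <-].
rewrite -integralT_nnsfun.
have mh : measurable_fun setT (EFin \o h).
  by apply/measurable_EFinP.
rewrite (ge0_negligible_integral mN)//; last by move=> x _; rewrite lee_fin.
rewrite setTD; have mN' := measurableC mN.
rewrite integral_mkcond (_ : _ \_ _ = EFin \o proj_nnsfun h mN'); last first.
  apply/funext => x; rewrite patchE /= mindicE.
  by case: (x \in ~` N); rewrite ?mulr1 ?mulr0.
rewrite integralT_nnsfun; apply: ereal_sup_ubound.
exists (proj_nnsfun h mN') => // x /=.
rewrite mindicE; case: (boolP (x \in ~` N)) => [|_]; last by rewrite mulr0.
by rewrite inE mulr1 => /= Nx; rewrite (le_trans (hf x))// fg.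
Qed.

(* No measurability is required of [f] and [g]: the integral is a supremum over
   the simple functions below. *)
Lemma eq_integral_off_null (D N : set T) (f g : T -> \bar R) :
  measurable N -> mu N = 0 -> (forall x, D x -> ~ N x -> f x = g x) ->
  \int[mu]_(x in D) f x = \int[mu]_(x in D) g x.
Proof.
move=> mN N0 fg.
have fgD x : ~ N x -> (f \_ D) x = (g \_ D) x.
  by move=> Nx; rewrite !patchE; case: ifPn => // /set_mem Dx; exact: fg.
rewrite integral_mkcond [RHS]integral_mkcond integralE [RHS]integralE.
have aux (u v : T -> \bar R) : (forall x, 0 <= u x) -> (forall x, 0 <= v x) ->
    (forall x, ~ N x -> u x = v x) -> \int[mu]_x u x = \int[mu]_x v x.
  move=> u0 v0 uv; apply/eqP; rewrite eq_le.
  by rewrite !(ge0_le_integral_off_null mN N0)// => x Nx; rewrite uv.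
congr (_ - _); apply: aux => // x Nx.
- by rewrite !funeposE fgD.
- by rewrite !funenegE fgD.
Qed.

End null_modification.

(** * Substitution in integrals of nonnegative functions over the line *)

Section change_of_variables.
Local Open Scope ereal_scope.
Context {R : realType}.
Notation mu := (@lebesgue_measure R).
Import HBNNSimple.

Section density.
Variables (f : R -> R) (F : R -> R).
Hypotheses (f0 : forall x, (0 <= f x)%R) (cf : continuous f)
    (dF : forall x : R, is_derive x 1%R F (f x)).
Variable G : R -> R.
Hypotheses (ndF : {mono F : x y / (x <= y)%R}) (FG : cancel G F).

Let mf : measurable_fun [set: R] f.
Proof. exact: continuous_measurable_fun. Qed.

Let cF : continuous F.
Proof.
move=> x; apply: differentiable_continuous; apply/derivable1_diffP.
by case: (dF x).
Qed.

Let mF : measurable_fun [set: R] F.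
Proof. exact: continuous_measurable_fun. Qed.

Let nu (A : set R) := \int[mu]_(x in F @^-1` A) (f x)%:E.

Let mFA A : measurable A -> measurable (F @^-1` A).
Proof. by move=> mA; rewrite -[X in measurable X]setTI; exact: mF. Qed.

Let nu_set0 : nu set0 = 0.
Proof. by rewrite /nu preimage_set0 integral_set0. Qed.

Let nu_ge0 A : 0 <= nu A.
Proof. by apply: integral_ge0 => x _; rewrite lee_fin. Qed.

Let nu_sigma_additive : semi_sigma_additive nu.
Proof.
move=> A mA tA _; rewrite /nu preimage_bigcup ge0_integral_bigcup//.
- apply: is_cvg_nneseries => // n _ _; exact: nu_ge0.
- by move=> i; apply: mFA.
- by apply/measurable_EFinP; apply: measurable_funS mf.
- by move=> x _; rewrite lee_fin.
- apply/trivIsetP => i j _ _ ij; rewrite -preimage_setI.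
  by move/trivIsetP : tA => ->//; rewrite preimage_set0.
Qed.

HB.instance Definition _ := isMeasure.Build _ _ _ (nu : set (measurableTypeR R)
  -> \bar R)
  nu_set0 nu_ge0 nu_sigma_additive.

Let preimage_ocitv a b : F @^-1` `]a, b] = `]G a, G b]%classic.
Proof.
rewrite -{1}(FG a) -{1}(FG b).
by apply/seteqP; split=> x /=; rewrite !in_itv/= (leW_mono ndF) ndF.
Qed.

(** The fundamental theorem of calculus gives equality on half-open intervals, and Lebesgue measure
    is the only measure with these values. *)
Let nuE A : measurable A -> mu A = nu A.
Proof.
apply: lebesgue_measure_unique => _ [[a b] _ <-].
rewrite /= lebesgue_measure_itv/= lte_fin /nu preimage_ocitv.
have [ab|ba] := ltP a b; last first.
  rewrite set_itv_ge ?integral_set0// bnd_simp -leNgt.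
  by rewrite -ndF !FG.
rewrite (_ : \int[mu]_(x in _) _ = \int[mu]_(x in `[G a, G b]) (f x)%:E); last
  first.
  by rewrite integral_itv_obnd_cbnd//; apply: measurable_funTS;
    exact/measurable_EFinP.
rewrite (@continuous_FTC2 _ f F) ?FG//.
- by rewrite -(leW_mono ndF) !FG.
- by apply: continuous_subspaceT.
- split.
  + by move=> x _; case: (dF x).
  + by apply: cvg_at_right_filter; exact: cF.
  + by apply: cvg_at_left_filter; exact: cF.
- by move=> x _; rewrite derive1E; case: (dF x).
Qed.

(** Monotone approximation of [H] by simple functions reduces the claim to indicators of level sets,
    where it is [nuE]. The density [f] may vanish somewhere, as it does at 0 for the signed
    square. *)
Lemma ge0_integral_substitution (H : R -> \bar R) :
  measurable_fun setT H -> (forall x, 0 <= H x) ->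
  \int[mu]_x H x = \int[mu]_x (H (F x) * (f x)%:E).
Proof.
move=> mH H0.
have mHF : measurable_fun setT (fun x => H (F x)) by exact: measurableT_comp.
have mfE : measurable_fun setT (EFin \o f) by exact/measurable_EFinP.
pose h := @nnsfun_approx _ (measurableTypeR R) _ _ measurableT H mH.
have cvh x : (fun n => (h n x)%:E) @ \oo --> H x by exact: cvg_nnsfun_approx.
have mh n : measurable_fun setT (fun x => (h n x)%:E).
  exact/measurable_EFinP/measurable_funTS.
have mhF n : measurable_fun setT (fun x => (h n (F x))%:E).
  by apply: (measurableT_comp (mh n)).
have mhFf n : measurable_fun setT (fun x => (h n (F x))%:E * (f x)%:E).
  exact: emeasurable_funM.
have ndh x m n : (m <= n)%N -> (h m x <= h n x)%R.
  by move=> mn; exact/lefP/nd_nnsfun_approx.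
transitivity (limn (fun n => \int[mu]_x (h n x)%:E)).
  rewrite -monotone_convergence//.
  - by apply: eq_integral => x _; apply/esym/cvg_lim.
  - by move=> n x _; rewrite lee_fin.
  - by move=> x _ m n mn; rewrite lee_fin ndh.
transitivity (limn (fun n => \int[mu]_x ((h n (F x))%:E * (f x)%:E))); last
  first.
  rewrite -monotone_convergence//.
  - apply: eq_integral => x _; apply/cvg_lim => //.
    by apply: cvgeZr => //; exact: cvh.
  - by move=> n x _; rewrite -EFinM lee_fin mulr_ge0.
  - by move=> x _ m n mn; rewrite lee_wpmul2r ?lee_fin// ndh.
congr (limn _); apply/funext => n; rewrite integralT_nnsfun sintegralE.
under [RHS]eq_integral.
  move=> x _; rewrite fimfunE -fsumEFin// ge0_mule_fsuml; last first.
    by move=> r; rewrite EFinM nnfun_muleindic_ge0.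
  over.
have mhr r : measurable (h n @^-1` [set r] : set (measurableTypeR R)) by [].
have mi r : measurable_fun setT
    (fun x => (r * \1_(h n @^-1` [set r]) (F x))%:E * (f x)%:E).
  apply: emeasurable_funM => //; apply/measurable_EFinP.
  apply: measurable_funM => //; apply: (measurableT_comp _ mF) => //.
  by apply: measurable_indic; exact: mhr.
rewrite ge0_integral_fsum//; last 1 first.
- move=> r x _; apply: mule_ge0; last by rewrite lee_fin.
  by rewrite EFinM nnfun_muleindic_ge0.
apply: eq_fsbigr => r /set_mem[t _ rE].
have r0 : (0 <= r)%R by rewrite -rE.
transitivity (r%:E * nu (h n @^-1` [set r])); first by congr (_ * _); exact/nuE.
have mr : measurable_fun setT ((EFin \o f) \_ (F @^-1` (h n @^-1` [set r]))).
  by apply/(measurable_restrictT _ _).1; [apply: mFA; exact: mhr|exact: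
    measurable_funTS].
rewrite /nu [X in _ * X]integral_mkcond -ge0_integralZl ?lee_fin//; last first.
  by move=> x _; rewrite patchE; case: ifPn; rewrite /= ?lee_fin.
apply: eq_integral => x _; rewrite patchE indicE EFinM -muleA; congr (_ * _).
have -> : (x \in F @^-1` (h n @^-1` [set r])) = (F x \in h n @^-1` [set r]).
  by apply/idP/idP; rewrite !inE.
by case: ifPn; rewrite ?mul1e ?mul0e.
Qed.

End density.

Lemma ge0_integral_translate (H : R -> \bar R) (c : R) :
  measurable_fun setT H -> (forall x, 0 <= H x) ->
  \int[mu]_x H (x + c)%R = \int[mu]_x H x.
Proof.
move=> mH H0; rewrite [RHS](@ge0_integral_substitution (cst 1%R) (fun x => x +
  c)%R _ _ _ (fun x => x - c)%R)//.
- by apply: eq_integral => x _; rewrite mule1.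
- exact: cst_continuous.
- by move=> x; apply: is_derive_eq; rewrite addr0.
- by move=> x y; rewrite lerD2r.
- by move=> x; rewrite subrK.
Qed.

Lemma ge0_integral_scale (H : R -> \bar R) (c : R) : (0 < c)%R ->
  measurable_fun setT H -> (forall x, 0 <= H x) ->
  \int[mu]_x H x = c%:E * \int[mu]_x H (c * x)%R.
Proof.
move=> c0 mH H0.
rewrite (@ge0_integral_substitution (cst c) (fun x => c * x)%R _ _ _ (fun x =>
  x / c)%R)//.
- rewrite -ge0_integralZl ?lee_fin ?ltW//; last first.
    by apply: measurableT_comp => //; exact: measurable_funM.
  by apply: eq_integral => x _; rewrite muleC.
- by move=> x /=; rewrite ltW.
- exact: cst_continuous.
- by move=> x; apply: is_derive_eq; rewrite /GRing.scale/= ?mulr0 ?addr0 mulr1.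
- by move=> x y; rewrite ler_pM2l.
- by move=> x; rewrite mulrC divfK// gt_eqF.
Qed.

Lemma ge0_integral_fold (H : R -> \bar R) :
  measurable_fun setT H -> (forall x, 0 <= H x) ->
  \int[mu]_x H x = \int[mu]_(x in `[0%R, +oo[) (H x + H (- x)%R).
Proof.
move=> mH H0.
have mHN : measurable_fun setT (fun x : R => H (- x)%R) by exact:
  measurableT_comp.
have mI : measurable (`[0%R, +oo[ : set R) by exact: measurable_itv.
have mJ : measurable (`]-oo, 0%R] : set R) by exact: measurable_itv.
have mK : measurable (`]0%R, +oo[ : set R) by exact: measurable_itv.
rewrite ge0_integralD//; last 2 first.
- exact: measurable_funTS.
- exact: measurable_funTS.
rewrite (ge0_integration_by_substitution0 mHN)//.
under [X in _ = _ + X]eq_integral do rewrite opprK.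
rewrite -(integral_itv_obnd_cbnd (f := H)); last exact: measurable_funTS.
rewrite -ge0_integral_setU//.
- by rewrite setUC itv_setU_setT.
- exact: measurable_funTS.
- apply/disj_setPS => x [] /=; rewrite !in_itv/= andbT => x0 x0'.
  by move: (lt_le_trans x0 x0'); rewrite ltxx.
Qed.

End change_of_variables.

Section signed_square.
Context {R : realType}.
Implicit Type x : R.

(** The square is not injective; the signed square is an increasing bijection of the line with a
    continuous derivative, so the substitution rule on the whole line applies to it. *)
Lemma is_derive_signed_square x : is_derive x 1 (fun y : R => y * `|y|) (2 *
  `|x|).
Proof.
have [x0|x0|->] := ltgtP x 0.
- apply: (@near_eq_is_derive _ _ _ (fun y : R => - (y ^+ 2))).
    near=> y; rewrite ltr0_norm; first by rewrite expr2 mulrN.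
    by near: y; exact: lt_nbhsl.
  by apply: is_derive_eq; rewrite ltr0_norm// /GRing.scale/=; ring.
- apply: (@near_eq_is_derive _ _ _ (fun y : R => y ^+ 2)).
    near=> y; rewrite gtr0_norm; first by rewrite expr2.
    by near: y; exact: lt_nbhsr.
  by apply: is_derive_eq; rewrite gtr0_norm// /GRing.scale/=; ring.
- rewrite normr0 mulr0.
  (* At 0 the difference quotient is the absolute value of the increment. *)
  suff cv : h^-1 *: (((h *: (1 : R) + 0) * `|h *: (1 : R) + 0|) - 0 * `|0 : R|)
    @[h --> (0 : R)^'] --> (0 : R).
    by split; [apply/cvg_ex; exists 0; exact: cv|apply/cvg_lim => //; exact:
      cv].
  apply: (@cvg_trans _ ((fun h : R => `|h|) @ (0:R)^')).
    apply: near_eq_cvg; near=> h.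
    rewrite /GRing.scale/= mulr1 addr0 mul0r subr0 mulrA mulVf ?mul1r//.
    by near: h; exact: nbhs_dnbhs_neq.
  apply: cvg_within_filter; have := @norm_continuous _ R (0 : R).
  by rewrite /continuous_at normr0.
Unshelve. all: by end_near. Qed.

Lemma ler_signed_square : {mono (fun x => x * `|x|) : x y / x <= y}.
Proof.
apply: le_mono => x y xy; have [y0|y0] := ltP y 0.
  by rewrite !ltr0_norm ?(lt_trans xy)//; nra.
have [x0|x0] := leP 0 x; first by rewrite !ger0_norm//; nra.
rewrite (@lt_le_trans _ _ 0)// ?mulr_ge0//.
by rewrite ltr0_norm//; nra.
Qed.

Lemma signed_sqrtK : cancel (fun x => Num.sg x * Num.sqrt `|x|) (fun x => x *
  `|x|).
Proof.
move=> x /=; have [x0|x0|->] := ltgtP x 0.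
- rewrite ltr0_sg// mulN1r normrN (ger0_norm (sqrtr_ge0 _)) mulNr -expr2
    sqr_sqrtr//.
  by rewrite ltr0_norm// opprK.
- rewrite gtr0_sg// mul1r (ger0_norm (sqrtr_ge0 _)) -expr2 sqr_sqrtr//.
  by rewrite gtr0_norm.
- by rewrite sgr0 !mul0r.
Qed.

Lemma ge0_integral_signed_square (H : R -> \bar R) :
  measurable_fun setT H -> (forall x, (0 <= H x)%E) ->
  (\int[@lebesgue_measure R]_x H x =
   \int[@lebesgue_measure R]_x (H (x * `|x|)%R * (2 * `|x|)%:E))%E.
Proof.
move=> mH H0.
have f0 x : 0 <= 2 * `|x| by rewrite mulr_ge0.
have cf : continuous (fun x => 2 * `|x|).
  by move=> x; apply: cvgM; [exact: cvg_cst|exact: norm_continuous].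
exact: (ge0_integral_substitution f0 cf is_derive_signed_square
  ler_signed_square signed_sqrtK mH H0).
Qed.

End signed_square.

Section borel_modification.
Context {R : realType}.
Notation mu := (@lebesgue_measure R).

(* The rational level sets of [f] are Borel up to null sets; off the union of
   these countably many null sets, [f] is Borel. *)
Lemma lebesgue_measurable_fun_borel (D : set R) (f : R -> R) :
  measurable D -> lebesgue_measurable_fun D f ->
  exists (g : R -> R) (N : set R), [/\ measurable_fun setT g, measurable N, mu
    N = 0%E,
    (forall x, ~ D x -> g x = 0) & (forall x, D x -> ~ N x -> f x = g x)].
Proof.
move=> mD mf.
(* [q] enumerates the rationals; numbers that code none give 0, which is a mere repetition. *)
pose q n : R := ratr (odflt 0%Q (unpickle n)).
(* [P n] is a Borel set together with a null set outside which it coincides with the part of [D]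
   where f > [q n]. *)
have /choice[P hP] (n : nat) : exists BN : set R * set R,
   [/\ measurable BN.1, measurable BN.2, mu BN.2 = 0%E &
     forall x, ~ BN.2 x -> (D x /\ q n < f x) <-> BN.1 x].
  have [B mB [N [M [mM M0 NM]] BN]] := mf `]q n, +oo[%classic (measurable_itv
    _).
  exists (B, M); split => //= x Mx; split.
    move=> [Dx qfx]; have : (B `|` N) x.
      by rewrite BN; split => //=; rewrite in_itv/= qfx.
    by case=> // /NM.
  move=> Bx; have : (B `|` N) x by left.
  by rewrite BN => -[? /=]; rewrite in_itv/= andbT.
pose N := \bigcup_n (P n).2.
have mN : measurable N by apply: bigcupT_measurable => n; have [] := hP n.
have N0 : mu N = 0%E.
  have : mu.-negligible N.
    apply: negligible_bigcup => n; exists (P n).2.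
    by have [_ ? ? _] := hP n; split.
  by apply: measure_negligible.
exists (f \_ (D `\` N)), N; split => //.
- apply/(measurable_restrictT _ _).1; first exact: measurableD.
  apply: (measurability _ (RGenOInfty.measurableE R)) => _ [_ [r ->] <-].
  (* f(x) > r exactly when f(x) > q > r for some rational q: a countable union of Borel sets with
     [N] removed. *)
  rewrite (_ : _ `&` _ = \bigcup_n (if r < q n then (P n).1 `\` N else set0)).
    apply: bigcupT_measurable => n; case: ifPn => // _.
    by apply: measurableD => //; have [] := hP n.
  apply/seteqP; split=> [x /= [[Dx Nx]]|x [n _]].
    rewrite in_itv/= andbT => /rat_in_itvoo[p].
    rewrite in_itv/= => /andP[rp pf].
    have qE : q (pickle p) = ratr p by rewrite /q pickleK.
    exists (pickle p) => //; rewrite qE rp; split => //.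
    have [_ _ _ /(_ x)[]] := hP (pickle p); first by move=> ?; apply: Nx;
      exists (pickle p).
    by move=> + _; apply; rewrite qE.
  case: ifPn => // rq [Px Nx].
  have [_ _ _ /(_ x)[]] := hP n; first by move=> ?; apply: Nx; exists n.
  move=> _ /(_ Px)[Dx qf]; split => //=.
  by rewrite in_itv/= andbT (lt_trans rq).
- by move=> x Dx; rewrite patchE; case: ifPn => // /set_mem[].
- by move=> x Dx Nx; rewrite patchE mem_set.
Qed.

End borel_modification.

(** * Powers, Gamma and Beta integrals *)

Section pospow.
Context {R : realType}.
Implicit Types a b c x : R.

(** The truncated power x_+^(a-1). The cut-off turns Gamma, Beta and Riemann-Liouville integrals
    into integrals over the whole line, and with the shifted exponent the indices add under
    convolution. *)
Definition pospow a x : R := x `^ (a - 1) * \1_(`]0, +oo[%classic : set R) x.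

Lemma pospow_gt0E a x : 0 < x -> pospow a x = x `^ (a - 1).
Proof. by move=> x0; rewrite /pospow indicE mem_set ?mulr1//= in_itv/= x0. Qed.

Lemma pospow_le0E a x : x <= 0 -> pospow a x = 0.
Proof.
move=> x0; rewrite /pospow indicE memNset ?mulr0//= in_itv/= andbT.
by move=> /(le_lt_trans x0); rewrite ltxx.
Qed.

Lemma pospow_ge0 a x : 0 <= pospow a x.
Proof. by rewrite mulr_ge0// powR_ge0. Qed.

Lemma epospow_mul_ge0 a b x y : (0 <= (pospow a x * pospow b y)%:E)%E.
Proof. by rewrite lee_fin mulr_ge0 ?pospow_ge0. Qed.

Lemma pospow_gt0 a x : 0 < x -> 0 < pospow a x.
Proof. by move=> x0; rewrite pospow_gt0E// powR_gt0. Qed.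

Lemma measurable_pospow a : measurable_fun setT (pospow a).
Proof.
apply: measurable_funM; first exact: measurable_powR.
by apply: measurable_indic; exact: measurable_itv.
Qed.

Lemma pospowZ a c x : 0 < c -> pospow a (c * x) = c `^ (a - 1) * pospow a x.
Proof.
move=> c0; have [x0|x0] := leP x 0.
  by rewrite !pospow_le0E ?mulr0// pmulr_rle0.
by rewrite !pospow_gt0E ?mulr_gt0// powRM// ltW.
Qed.

Lemma pospow1 x : 0 < x -> pospow 1 x = 1.
Proof. by move=> x0; rewrite pospow_gt0E// subrr powRr0. Qed.

Lemma pospow_mul_le0 a b x w : w <= 0 -> pospow a x * pospow b (w - x) = 0.
Proof.
move=> w0; have [x0|x0] := leP x 0; first by rewrite pospow_le0E// mul0r.
by rewrite [X in _ * X]pospow_le0E ?mulr0// subr_le0 (le_trans w0)// ltW.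
Qed.

End pospow.

Section pospow_convolution.
Local Open Scope ereal_scope.
Context {R : realType}.
Notation mu := (@lebesgue_measure R).
Implicit Types (a b : R) (p s : R -> \bar R).

(** The inverse is the difference of two truncated powers of exponent -1, one for each half-line; at
    0 both vanish, in accordance with the convention 1/0 = 0. *)
Lemma measurable_fun_invr : measurable_fun setT (fun x : R => x^-1)%R.
Proof.
rewrite (_ : (fun _ => _) = (fun x => pospow 0 x - pospow 0 (- x))%R); last
  first.
  apply/funext => x; have [x0|x0|->] := ltgtP x 0%R.
  - rewrite pospow_le0E ?ltW// sub0r pospow_gt0E ?oppr_gt0// sub0r powR_inv1;
      last first.
      by rewrite oppr_ge0 ltW.
    by rewrite invrN opprK.
  - by rewrite [X in (_ - X)%R]pospow_le0E ?oppr_le0 ?ltW// subr0 pospow_gt0E//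
      sub0r powR_inv1// ltW.
  - by rewrite oppr0 subrr invr0.
apply: measurable_funB; first exact: measurable_pospow.
exact: (measurableT_comp (measurable_pospow 0)).
Qed.

Lemma ge0_fubini_tonelliR (X : R * R -> \bar R) :
  measurable_fun setT X -> (forall z, 0 <= X z) ->
  \int[mu]_x \int[mu]_y X (x, y) = \int[mu]_y \int[mu]_x X (x, y).
Proof.
move=> mX X0.
exact: (@fubini_tonelli _ _ (measurableTypeR R) (measurableTypeR R) R mu mu X
  mX X0).
Qed.

Lemma measurable_pospow_conv a b s (w : R) : measurable_fun setT s ->
  measurable_fun setT (fun u : R => s (u / w)%R * (pospow a u * pospow b (w -
    u))%:E).
Proof.
move=> ms; apply: emeasurable_funM.
  by apply: (measurableT_comp ms); exact: measurable_funM.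
apply/measurable_EFinP; apply: measurable_funM; first exact: measurable_pospow.
by apply: (measurableT_comp (measurable_pospow b)); exact: measurable_funB.
Qed.

(** For w > 0 substitute u = w v: the Jacobian and the homogeneity of the two powers give w *
    w^(a-1) * w^(b-1) = w^(a+b-1). For w <= 0 one of the two truncated powers always vanishes. *)
Lemma ge0_integral_pospow_conv a b s (w : R) :
  measurable_fun setT s -> (forall x, 0 <= s x) ->
  \int[mu]_u (s (u / w)%R * (pospow a u * pospow b (w - u))%:E) =
  (pospow (a + b) w)%:E * \int[mu]_v (s v * (pospow a v * pospow b (1 - v))%:E).
Proof.
move=> ms s0.
have m0 : measurable_fun setT (fun v : R => s v * (pospow a v * pospow b (1 -
  v))%:E).
  have := measurable_pospow_conv a b 1 ms.
  by under eq_fun do rewrite divr1.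
have [w0|w0] := leP w 0%R.
  rewrite (pospow_le0E _ w0) mul0e; apply: integral0_eq => u _.
  by rewrite pospow_mul_le0// mule0.
rewrite (ge0_integral_scale w0); last 2 first.
- exact: measurable_pospow_conv.
- by move=> x; apply: mule_ge0 => //; exact: epospow_mul_ge0.
have m1 : measurable_fun setT (fun v : R => s ((w * v) / w)%R * (pospow a (w *
  v) * pospow b (w - w * v))%:E).
  by apply: (measurableT_comp (measurable_pospow_conv a b w ms)); exact:
    measurable_funM.
have pE : (w `^ (a + b - 1) = w * (w `^ (a - 1) * w `^ (b - 1)))%R.
  rewrite -powRD; last by rewrite (gt_eqF w0) implybT.
  rewrite -[X in (X * _)%R](powRr1 (ltW w0)) -powRD ?(gt_eqF w0) ?implybT//.
  by congr (_ `^ _)%R; ring.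
rewrite -!ge0_integralZl ?lee_fin ?(ltW w0) ?pospow_ge0//; last 2 first.
- by move=> x _; apply: mule_ge0 => //; exact: epospow_mul_ge0.
- by move=> x _; apply: mule_ge0 => //; exact: epospow_mul_ge0.
apply: eq_integral => v _; rewrite (_ : w - w * v = w * (1 - v))%R; last by
  ring.
rewrite !pospowZ//.
rewrite [(w * v)%R]mulrC mulfK ?gt_eqF// [pospow (a + b) w]pospow_gt0E// pE.
rewrite muleCA [RHS]muleCA -!EFinM; congr (_ * _%:E); ring.
Qed.

(** The sum w = u + r and the ratio v = u/(u + r) separate, as they do for independent Gamma
    variables. For fixed u translate r to w - u, exchange the integrals, and apply the convolution
    rule for fixed w. Three choices of [p] and [s] serve below: for the product of Gamma values, for
    squared norms, and for the sphere. *)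
Lemma ge0_integral_pospow_polar a b p s :
  measurable_fun setT p -> (forall x, 0 <= p x) ->
  measurable_fun setT s -> (forall x, 0 <= s x) ->
  \int[mu]_u \int[mu]_r
    ((pospow a u * pospow b r)%:E * (p (u + r)%R * s (u / (u + r))%R)) =
  \int[mu]_w (p w * (pospow (a + b) w)%:E) *
  \int[mu]_v (s v * (pospow a v * pospow b (1 - v))%:E).
Proof.
move=> mp p0 ms s0.
pose X (z : R * R) :=
  p z.2 * (s (z.1 / z.2)%R * (pospow a z.1 * pospow b (z.2 - z.1))%:E).
have m1 : measurable_fun setT (fst : R * R -> R) by exact: measurable_fst.
have m2 : measurable_fun setT (snd : R * R -> R) by exact: measurable_snd.
have mX : measurable_fun setT X.
  apply: emeasurable_funM; first exact: (measurableT_comp mp).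
  apply: emeasurable_funM.
    apply: (measurableT_comp ms); apply: measurable_funM => //.
    exact: (measurableT_comp measurable_fun_invr m2).
  apply/measurable_EFinP; apply: measurable_funM.
    exact: measurableT_comp (measurable_pospow a) m1.
  apply: (measurableT_comp (measurable_pospow b)).
  exact: measurable_funB.
have X0 z : 0 <= X z by apply: mule_ge0 => //; apply: mule_ge0 => //; exact:
  epospow_mul_ge0.
have mXu u : measurable_fun setT (fun w => X (u, w)).
  by apply: (measurableT_comp mX); exact: measurable_fun_pair.
have mB : measurable_fun setT (fun v : R => s v * (pospow a v * pospow b (1 -
  v))%:E).
  have := measurable_pospow_conv a b 1 ms.
  by under eq_fun do rewrite divr1.
have mP : measurable_fun setT (fun w => p w * (pospow (a + b) w)%:E).
  by apply: emeasurable_funM => //; apply/measurable_EFinP; exact: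
    measurable_pospow.
have B0 v : 0 <= s v * (pospow a v * pospow b (1 - v))%:E.
  by apply: mule_ge0 => //; exact: epospow_mul_ge0.
transitivity (\int[mu]_u \int[mu]_w X (u, w)).
  apply: eq_integral => u _; rewrite -(ge0_integral_translate u (mXu u))//.
  by apply: eq_integral => r _; rewrite /X/= addrK (addrC r u) muleC -muleA.
rewrite (ge0_fubini_tonelliR mX X0).
rewrite -ge0_integralZr//; last 2 first.
- by move=> w _; apply: mule_ge0 => //; rewrite lee_fin pospow_ge0.
- exact: integral_ge0.
apply: eq_integral => w _; rewrite -muleA -ge0_integral_pospow_conv//
  -ge0_integralZl//.
- exact: measurable_pospow_conv.
- by move=> u _; apply: mule_ge0 => //; exact: epospow_mul_ge0.
Qed.

(** Both roots of u = x^2 contribute, each with the density u^(-1/2)/2. The signed square is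
    substituted on the right, where the truncated power removes the negative half-line. *)
Lemma ge0_integral_sqrt (H : R -> \bar R) :
  measurable_fun setT H -> (forall x, 0 <= H x) ->
  \int[mu]_x H x =
  \int[mu]_u ((pospow 2^-1 u / 2)%:E * (H (Num.sqrt u) + H (- Num.sqrt u)%R)).
Proof.
move=> mH H0.
have ms : measurable_fun setT (@Num.sqrt R).
  by apply: continuous_measurable_fun; exact: sqrt_continuous.
have mHs : measurable_fun setT (fun u : R => H (Num.sqrt u) + H (- Num.sqrt
  u)%R).
  by apply: emeasurable_funD; apply: measurableT_comp => //; exact:
    measurableT_comp.
have mG : measurable_fun setT
    (fun u : R => (pospow 2^-1 u / 2)%:E * (H (Num.sqrt u) + H (- Num.sqrt
      u)%R)).
  apply: emeasurable_funM => //; apply/measurable_EFinP.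
  by apply: measurable_funM => //; exact: measurable_pospow.
rewrite [RHS]ge0_integral_signed_square//; last first.
  move=> u; apply: mule_ge0; last exact: adde_ge0.
  by rewrite lee_fin divr_ge0 ?pospow_ge0.
rewrite ge0_integral_fold// -integral_itv_obnd_cbnd; last first.
  apply: measurable_funTS; apply: emeasurable_funD => //.
  exact: (measurableT_comp mH).
rewrite integral_mkcond; apply: eq_integral => x _; rewrite patchE.
case: ifPn => [/set_mem/=|]; last first.
  move=> /negP x0; rewrite pospow_le0E ?mul0r ?mul0e//.
  have : (x <= 0)%R by rewrite leNgt; apply/negP => ?; apply: x0; rewrite inE/=
    in_itv/= andbT.
  by move=> ?; rewrite mulr_le0_ge0.
rewrite in_itv/= andbT => x0; rewrite gtr0_norm// pospow_gt0E ?mulr_gt0//.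
rewrite -expr2 sqrtr_sqr gtr0_norm// muleC muleA -EFinM.
rewrite (_ : (2 * x * _ = 1)%R) ?mul1e//.
rewrite -powR_mulrn ?ltW// -powRrM.
rewrite (_ : 2%:R * (2^-1 - 1) = -1 :> R)%R; last by field.
by rewrite powR_inv1 ?ltW//; field; rewrite gt_eqF.
Qed.

(** A vanishing integral would force f = 0 almost everywhere, against positivity on an interval of
    measure 1. *)
Lemma ge0_integral_gt0 (f : R -> R) : measurable_fun setT f ->
  (forall x, (0 <= f x)%R) -> (forall x, (0 < x < 1)%R -> (0 < f x)%R) ->
  0 < \int[mu]_x (f x)%:E.
Proof.
move=> mf f0 f1; rewrite lt0e integral_ge0 ?andbT; last first.
  by move=> x _; rewrite lee_fin.
apply/eqP => f_eq0.
have [] := @ae_eq_integral_abs _ (measurableTypeR R) R mu setT measurableT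
  (EFin \o f).
  exact/measurable_EFinP.
have -> : \int[mu]_x `|(EFin \o f) x| = 0.
  by rewrite -f_eq0; apply: eq_integral => x _; rewrite gee0_abs// lee_fin.
move=> /(_ erefl) [N [mN N0 fN]] _.
have : mu `]0%R, 1%R[ <= mu N.
  have mI : measurable (`]0%R, 1%R[ : set R) by exact: measurable_itv.
  apply: le_measure; rewrite ?inE//.
  move=> x /=; rewrite in_itv/= => /f1 fx; apply: fN => /= /(_ I)[] fx0.
  by move: fx; rewrite fx0 ltxx.
by rewrite N0 lebesgue_measure_itv/= lte01 oppr0 adde0 lee_fin ler10.
Qed.

End pospow_convolution.

(** * Gamma and Beta integrals at half-integers *)

Section gamma_beta.
Local Open Scope ereal_scope.
Context {R : realType}.
Notation mu := (@lebesgue_measure R).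
Implicit Types a b : R.

(** Extended-real values, so that the product formula can be proved before finiteness and finiteness
    deduced from it. *)
Definition egamma a := \int[mu]_y (pospow a y * expR (- y))%:E.

Definition ebeta a b := \int[mu]_v (pospow a v * pospow b (1 - v))%:E.

Lemma measurable_gamma_integrand a : measurable_fun setT (fun y : R => pospow a
  y * expR (- y))%R.
Proof.
apply: measurable_funM; first exact: measurable_pospow.
exact: measurableT_comp.
Qed.

Lemma GammaE a : Gamma a = fine (egamma a).
Proof.
rewrite /Gamma /Rintegral integral_mkcond; congr fine; apply: eq_integral => y
  _.
by rewrite patchE /pospow indicE; case: ifPn; rewrite ?mulr1 ?mulr0 ?mul0r.
Qed.

Lemma egamma_gt0 a : 0 < egamma a.
Proof.
apply: ge0_integral_gt0; first exact: measurable_gamma_integrand.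
- by move=> x; rewrite mulr_ge0 ?pospow_ge0 ?expR_ge0.
- by move=> x /andP[x0 _]; rewrite mulr_gt0 ?pospow_gt0 ?expR_gt0.
Qed.

Lemma ebeta_gt0 a b : 0 < ebeta a b.
Proof.
apply: ge0_integral_gt0.
- apply: measurable_funM; first exact: measurable_pospow.
  by apply: (measurableT_comp (measurable_pospow b)); exact: measurable_funB.
- by move=> x; rewrite mulr_ge0 ?pospow_ge0.
- by move=> x /andP[x0 x1]; rewrite mulr_gt0 ?pospow_gt0 ?subr_gt0.
Qed.

(** The separation of sum and ratio, with exp(-w) as the function of the sum and 1 as that of the
    ratio. *)
Lemma egammaM a b : egamma a * egamma b = egamma (a + b) * ebeta a b.
Proof.
have mE : measurable_fun setT (fun w : R => (expR (- w))%:E).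
  by apply/measurable_EFinP; exact: measurableT_comp.
have := @ge0_integral_pospow_polar R a b (fun w => (expR (- w))%:E) (cst 1) mE.
move=> /(_ (fun x => _) (measurable_cst _) (fun x => lee01)).
move=> E; transitivity (\int[mu]_w ((expR (- w))%:E * (pospow (a + b) w)%:E) *
    \int[mu]_v (cst 1 v * (pospow a v * pospow b (1 - v))%:E)); last first.
  congr (_ * _); apply: eq_integral => x _; first by rewrite -EFinM mulrC.
  by rewrite mul1e.
rewrite -E; last by move=> x; rewrite lee_fin expR_ge0.
have mg := measurable_gamma_integrand.
have mgE c : measurable_fun setT (fun y : R => (pospow c y * expR (- y))%:E).
  by apply/measurable_EFinP; exact: mg.
have g0 (c x : R) : 0 <= (pospow c x * expR (- x))%:E.
  by rewrite lee_fin mulr_ge0 ?pospow_ge0 ?expR_ge0.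
rewrite -ge0_integralZr//; last exact: integral_ge0.
apply: eq_integral => u _; rewrite -ge0_integralZl//.
apply: eq_integral => r _; rewrite mule1 -!EFinM opprD expRD.
by congr EFin; ring.
all: exact: mgE.
Qed.

(** The Gaussian integral over the line, rewritten in u = x^2. *)
Lemma egamma_half : egamma 2^-1 = (Num.sqrt pi)%:E.
Proof.
rewrite -integralT_gauss ge0_integral_sqrt; last 2 first.
- by apply/measurable_EFinP; exact: measurable_gauss_fun.
- by move=> x; rewrite lee_fin gauss_fun_ge0.
apply: eq_integral => u _; rewrite /gauss_fun sqrrN -EFinD -EFinM.
have [u0|u0] := leP u 0%R; first by rewrite !pospow_le0E// !mul0r.
by rewrite sqr_sqrtr ?ltW//; congr EFin; field.
Qed.

(** Induction in steps of 1/2: were Gamma(b + 1/2) infinite, its product with the positive B(1/2, b)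
    would be infinite, whereas Gamma(1/2) Gamma(b) is finite. *)
Lemma egamma_halfint_fin k : egamma (k.+1%:R / 2) \is a fin_num.
Proof.
elim: k => [|k IH]; first by rewrite div1r egamma_half.
have := egammaM 2^-1 (k.+1%:R / 2).
rewrite (_ : 2^-1 + k.+1%:R / 2 = k.+2%:R / 2 :> R)%R; last first.
  by rewrite -[k.+2%:R]natr1; field.
rewrite egamma_half => E; rewrite ge0_fin_numE ?ltW ?egamma_gt0// ltey.
apply/eqP => goo; move: E; rewrite goo gt0_mulye ?ebeta_gt0//.
by rewrite -(fineK IH) -EFinM.
Qed.

Lemma egamma_halfint k : egamma (k.+1%:R / 2) = (Gamma (k.+1%:R / 2 : R))%:E.
Proof. by rewrite GammaE fineK// egamma_halfint_fin. Qed.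

Lemma Gamma_halfint_gt0 k : (0 < Gamma (k.+1%:R / 2 : R))%R.
Proof. by rewrite -lte_fin -egamma_halfint egamma_gt0. Qed.

Lemma Gamma_half : Gamma (2^-1 : R) = Num.sqrt pi.
Proof. by rewrite GammaE egamma_half. Qed.

Lemma Gamma1 : Gamma (1 : R) = 1%R.
Proof.
rewrite GammaE; suff -> : egamma 1 = 1 by [].
rewrite -[RHS](@integral_exponential_pdf R 1)//.
rewrite /egamma; apply: (@eq_integral_off_null _ (measurableTypeR R) R mu setT
  [set 0%R]).
- exact: measurable_set1.
- exact: lebesgue_measure_set1.
move=> x _ x0; congr EFin; rewrite /exponential_pdf patchE; case: ifPn.
  rewrite inE/= in_itv/= andbT le_eqVlt => /predU1P[x0'|xgt].
    by exfalso; apply: x0; rewrite -x0'.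
  by rewrite pospow1// !mul1r mulN1r.
rewrite notin_setE/= in_itv/= andbT => /negP; rewrite -ltNge => xlt.
by rewrite pospow_le0E ?mul0r// ltW.
Qed.

End gamma_beta.

(** * Lebesgue measure on tuples and the surface measure *)

Section mrestr.
Local Open Scope ereal_scope.
Context d (T : measurableType d) (R : realType).
Variables (mu : {measure set T -> \bar R}) (D : set T) (mD : measurable D).

(** [mu] is the sum of its restrictions to [D] and to the complement, and [f] cut off to [D] is null
    for the second. *)
Lemma ge0_integral_mrestr (f : T -> \bar R) : measurable_fun setT f ->
  (forall x, 0 <= f x) ->
  \int[mrestr mu mD]_x f x = \int[mu]_(x in D) f x.
Proof.
move=> mf f0.
have mD' := measurableC mD.
have mfD : measurable_fun setT (f \_ D).
  by apply/(measurable_restrictT _ _).1 => //; exact: measurable_funTS.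
have fD0 x : 0 <= (f \_ D) x by rewrite patchE; case: ifPn.
rewrite [RHS]integral_mkcond.
rewrite [RHS](eq_measure_integral (measure_add (mrestr mu mD) (mrestr mu
  mD'))); last first.
  move=> A mA _; transitivity (mrestr mu mD A + mrestr mu mD' A); last first.
    by rewrite -measure_addE.
  rewrite /mrestr -measureU.
  - by rewrite -setIUr setUv setIT.
  - exact: measurableI.
  - exact: measurableI.
  - by rewrite setIACA setICr setI0.
rewrite ge0_integral_measure_add//.
rewrite [X in _ = _ + X](_ : _ = 0) ?adde0; last first.
  rewrite (eq_integral_off_null (N := D) (g := cst 0))// ?integral0//.
  - by rewrite /= /mrestr setICr measure0.
  - by move=> x _ xD; rewrite patchE memNset.
apply: (eq_integral_off_null (N := ~` D)) => //.
- by rewrite /= /mrestr setICl measure0.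
- by move=> x _ /contrapT xD; rewrite patchE mem_set.
Qed.

End mrestr.

Section scaled_pushforward.
Local Open Scope ereal_scope.
Context d d' (X : measurableType d) (Y : measurableType d') (R : realType).
Variables (m : {measure set X -> \bar R}) (phi : X -> Y).
Hypothesis mphi : measurable_fun setT phi.
Variables (nu : {measure set Y -> \bar R}) (c : {nonneg R}).
Hypothesis nuE : forall A, measurable A -> nu A = c%:num%:E * m (phi @^-1` A).

Lemma ge0_integral_scaled_pushforward (f : Y -> \bar R) :
  measurable_fun setT f -> (forall y, 0 <= f y) ->
  \int[nu]_y f y = c%:num%:E * \int[m]_x f (phi x).
Proof.
move=> mf f0.
pose p := measure_function_pushforward__canonical__measure_function_Measure m
  mphi.
rewrite (eq_measure_integral (mscale c p)); last by move=> A mA _; exact: nuE.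
rewrite ge0_integral_mscale//; congr (_ * _).
by rewrite -[RHS](ge0_integral_pushforward mphi m measurableT mf).
Qed.

End scaled_pushforward.

Section lebesgue_tuple_integral.
Local Open Scope ereal_scope.
Context {R : realType}.
Notation mu := (@lebesgue_measure R).
Notation mR := (measurableTypeR R).

Definition sqnorm k (y : k.-tuple mR) : R := (\sum_(i < k) tnth y i ^+ 2)%R.

Lemma measurable_sqnorm k : measurable_fun setT (@sqnorm k).
Proof.
by apply: measurable_sum => i; apply: measurable_funX; exact: measurable_tnth.
Qed.


Lemma sqnorm_tcons k (x : mR) (y : k.-tuple mR) :
  sqnorm (tcons (x, y)) = (x ^+ 2 + sqnorm y)%R.
Proof.
rewrite /sqnorm big_ord_recl tnth0; congr (_ + _)%R.
by apply: eq_bigr => i _; rewrite tnthS.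
Qed.

Lemma ge0_integral_lebesgue_tupleS k (H : k.+1.-tuple mR -> \bar R) :
  measurable_fun setT H -> (forall t, 0 <= H t) ->
  \int[@lebesgue_tuple R k.+1]_t H t =
  \int[mu]_x \int[@lebesgue_tuple R k]_y H (tcons (x, y)).
Proof.
move=> mH H0.
transitivity (\int[pushforward (mu \x @lebesgue_tuple R k) (@tcons R k)]_t H t).
  exact: eq_measure_integral.
rewrite ge0_integral_pushforward//; last exact: measurable_tcons.
rewrite preimage_setT (fubini_tonelli1 (H \o @tcons R k))//.
  by apply: measurableT_comp => //; exact: measurable_tcons.
by move=> z; exact: H0.
Qed.

Lemma ge0_integral_lebesgue_tuple0 (H : 0.-tuple mR -> \bar R) :
  measurable_fun setT H ->
  \int[@lebesgue_tuple R 0]_t H t = H [tuple].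
Proof.
move=> mH; transitivity (\int[\d_([tuple] : 0.-tuple mR)]_t H t).
  exact: eq_measure_integral.
by rewrite integral_dirac// diracT mul1e.
Qed.

(* Indexed so that it belongs to R^(k+1). *)
Definition ball_density k : R := (pi `^ (k.+1%:R / 2) / Gamma (k.+1%:R / 2))%R.

Lemma ball_density_ge0 k : (0 <= ball_density k)%R.
Proof. by rewrite divr_ge0 ?powR_ge0// ltW// Gamma_halfint_gt0. Qed.

(** As Gamma(1/2) = pi^(1/2), B(1/2, b) = pi^(1/2) Gamma(b) / Gamma(b + 1/2): precisely the factor
    gained with one more dimension. *)
Lemma ball_densityS k :
  (ball_density k)%:E * ebeta 2^-1 (k.+1%:R / 2) = (ball_density k.+1)%:E.
Proof.
have := egammaM 2^-1 (k.+1%:R / 2 : R).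
rewrite (_ : 2^-1 + k.+1%:R / 2 = k.+2%:R / 2 :> R)%R; last first.
  by rewrite -[k.+2%:R]natr1; field.
rewrite !egamma_halfint egamma_half -EFinM /ball_density => E.
have G1 := Gamma_halfint_gt0 (R := R) k; have G2 := Gamma_halfint_gt0 (R := R)
  k.+1.
have bfin : ebeta 2^-1 (k.+1%:R / 2 : R) \is a fin_num.
  rewrite ge0_fin_numE ?ltW ?ebeta_gt0// ltey; apply/eqP => boo.
  by move: E; rewrite boo gt0_muley ?lte_fin.
move: E; rewrite -(fineK bfin) -!EFinM => -[E]; congr EFin.
have -> : (k.+2%:R / 2 = 2^-1 + k.+1%:R / 2 :> R)%R.
  by rewrite -[k.+2%:R]natr1; field.
have -> : (pi `^ (2^-1 + k.+1%:R / 2) = Num.sqrt pi * pi `^ (k.+1%:R / 2) :>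
  R)%R.
  rewrite powRD ?powR12_sqrt ?pi_ge0//.
  by rewrite (gt_eqF (pi_gt0 R)) implybT.
have -> : (2^-1 + k.+1%:R / 2 = k.+2%:R / 2 :> R)%R.
  by rewrite -[k.+2%:R]natr1; field.
set s := Num.sqrt _ in E *; set g1 := Gamma (k.+1%:R / 2) in E G1 *.
set g2 := Gamma (k.+2%:R / 2) in E G2 *; set b := fine _ in E *.
have -> : (s = g2 * b / g1)%R by rewrite -E mulfK// gt_eqF.
by field; rewrite !gt_eqF.
Qed.

Lemma ge0_integralZR (c : R) (f : R -> \bar R) : (0 <= c)%R ->
  measurable_fun setT f -> (forall x, 0 <= f x) ->
  \int[mu]_x (c%:E * f x) = c%:E * \int[mu]_x f x.
Proof. by move=> c0 mf f0; apply: ge0_integralZl_EFin. Qed.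

Lemma measurable_integralR (X : R * R -> \bar R) : measurable_fun setT X ->
  (forall z, 0 <= X z) -> measurable_fun setT (fun x => \int[mu]_y X (x, y)).
Proof.
move=> mX X0; exact: (@measurable_fun_fubini_tonelli_F _ _ mR mR R mu X mX X0).
Qed.

Lemma ge0_integral_sqr (G : R -> \bar R) : measurable_fun setT G -> (forall x,
  0 <= G x) ->
  \int[mu]_x G (x ^+ 2)%R = \int[mu]_u ((pospow 2^-1 u)%:E * G u).
Proof.
move=> mG G0.
rewrite (ge0_integral_sqrt (H := fun x => G (x ^+ 2)%R))//; last first.
  by apply: measurableT_comp => //; exact: measurable_funX.
apply: eq_integral => u _; have [u0|u0] := leP u 0%R.
  by rewrite pospow_le0E// mul0r !mul0e.
rewrite sqrrN sqr_sqrtr ?(ltW u0)// EFinM -muleA; congr (_ * _).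
rewrite -[X in _ * (X + X)]mul1e -ge0_muleDl// -EFinD muleA -EFinM.
by rewrite -[X in (_ * X)%:E]/(2%:R) mulVf// mul1e.
Qed.

Lemma ge0_integral_sqnorm k (H : R -> \bar R) :
  measurable_fun setT H -> (forall x, 0 <= H x) ->
  \int[@lebesgue_tuple R k.+1]_t H (sqnorm t) =
  \int[mu]_u ((ball_density k * pospow (k.+1%:R / 2) u)%:E * H u).
Proof.
elim: k H => [|k IH] H mH H0.
  rewrite ge0_integral_lebesgue_tupleS//; last first.
    by apply: measurableT_comp => //; exact: measurable_sqnorm.
  transitivity (\int[mu]_x H (x ^+ 2)%R).
    apply: eq_integral => x _; rewrite ge0_integral_lebesgue_tuple0.
      by rewrite sqnorm_tcons /sqnorm big_ord0 addr0.
    apply: (measurableT_comp mH); apply: (measurableT_comp (@measurable_sqnorm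
      _)).
    by apply: (measurableT_comp (@measurable_tcons R 0)); exact:
      measurable_fun_pair.
  rewrite ge0_integral_sqr//; apply: eq_integral => u _.
  rewrite /ball_density div1r Gamma_half powR12_sqrt ?pi_ge0// divff ?mul1r//.
  by rewrite sqrtr_eq0 -ltNge pi_gt0.
rewrite ge0_integral_lebesgue_tupleS//; last first.
  by apply: measurableT_comp => //; exact: measurable_sqnorm.
have mS : measurable_fun setT (fun z : R * R => z.1 + z.2)%R.
  by apply: measurable_funD; [exact: measurable_fst|exact: measurable_snd].
pose X (z : R * R) := (ball_density k * pospow (k.+1%:R / 2) z.2)%:E * H (z.1 +
  z.2)%R.
have mX : measurable_fun setT X.
  apply: emeasurable_funM; last exact: measurableT_comp.
  apply/measurable_EFinP; apply: measurable_funM => //.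
  by apply: (measurableT_comp (measurable_pospow _)); exact: measurable_snd.
have X0 z : 0 <= X z.
  by apply: mule_ge0 => //; rewrite lee_fin mulr_ge0 ?ball_density_ge0
    ?pospow_ge0.
transitivity (\int[mu]_x \int[mu]_u X (x ^+ 2, u)%R).
  apply: eq_integral => x _; under eq_integral do rewrite sqnorm_tcons.
  rewrite (IH (fun u => H (x ^+ 2 + u)%R))//.
  by apply: measurableT_comp => //; exact: measurable_funD.
pose G x := \int[mu]_u X (x, u).
have mG : measurable_fun setT G.
  exact: (@measurable_fun_fubini_tonelli_F _ _ mR mR R mu X mX X0).
rewrite (ge0_integral_sqr (G := G))//; last by move=> x; exact: integral_ge0.
pose b : R := (k.+1%:R / 2)%R; pose c := ball_density k.
(* The idle factor 1 is the function of the ratio in [ge0_integral_pospow_polar], where only the sum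
   matters here. *)
pose Y (z : R * R) := (pospow 2^-1 z.1 * pospow b z.2)%:E * (H (z.1 + z.2)%R *
  1).
have c0 : (0 <= c)%R by exact: ball_density_ge0.
have mY : measurable_fun setT Y.
  apply: emeasurable_funM; last first.
    by apply: emeasurable_funM => //; exact: measurableT_comp.
  apply/measurable_EFinP; apply: measurable_funM.
    by apply: (measurableT_comp (measurable_pospow _)); exact: measurable_fst.
  by apply: (measurableT_comp (measurable_pospow _)); exact: measurable_snd.
have Y0 z : 0 <= Y z.
  by apply: mule_ge0; [exact: epospow_mul_ge0|rewrite mule1].
have section (Z : R * R -> \bar R) u : measurable_fun setT Z ->
    measurable_fun setT (fun r => Z (u, r)).
  by move=> mZ; apply: (measurableT_comp mZ); exact: measurable_fun_pair.
transitivity (\int[mu]_u (c%:E * \int[mu]_r Y (u, r))).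
  apply: eq_integral => u _; rewrite /G -ge0_integralZR ?pospow_ge0//; last
    exact: section.
  rewrite -ge0_integralZR//; last exact: section.
  apply: eq_integral => r _; rewrite /X /Y /= mule1 !muleA -!EFinM.
  by congr (_%:E * _); rewrite -/b -/c; ring.
rewrite ge0_integralZR//; last 2 first.
- exact: (measurable_integralR mY Y0).
- by move=> u; exact: integral_ge0.
rewrite (@ge0_integral_pospow_polar R 2^-1 b H (cst 1))//.
rewrite (_ : \int[mu]_v (cst 1 v * _) = ebeta 2^-1 b); last first.
  by apply: eq_integral => v _; rewrite mul1e.
have cb : c%:E * ebeta 2^-1 b = (ball_density k.+1)%:E := ball_densityS k.
rewrite muleCA cb.
rewrite (_ : 2^-1 + b = k.+2%:R / 2 :> R)%R; last first.
  by rewrite /b -[k.+2%:R]natr1; field.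
rewrite muleC -ge0_integralZR ?ball_density_ge0//.
- by apply: eq_integral => u _; rewrite EFinM muleCA muleC.
- by apply: emeasurable_funM => //; apply/measurable_EFinP; exact:
    measurable_pospow.
- by move=> u; apply: mule_ge0 => //; rewrite lee_fin pospow_ge0.
Qed.

(** The latitude keeps the sign of the first coordinate, so both roots of v = x^2 stay apart, while
    the remaining coordinates enter only through their squared norm. *)
Lemma ge0_integral_head_sqnorm k (F : R * R -> \bar R) :
  measurable_fun setT F -> (forall z, 0 <= F z) ->
  \int[mu]_x \int[@lebesgue_tuple R k.+1]_y F (x, sqnorm y) =
  \int[mu]_v \int[mu]_u ((ball_density k / 2 * (pospow 2^-1 v * pospow (k.+1%:R
    / 2) u))%:E *
    (F (Num.sqrt v, u) + F (- Num.sqrt v, u)%R)).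
Proof.
move=> mF F0; set b := (k.+1%:R / 2)%R; set c := ball_density k.
have c0 : (0 <= c)%R by exact: ball_density_ge0.
have section (Z : R * R -> \bar R) u : measurable_fun setT Z ->
    measurable_fun setT (fun r => Z (u, r)).
  by move=> mZ; apply: (measurableT_comp mZ); exact: measurable_fun_pair.
pose X (z : R * R) := (c * pospow b z.2)%:E * F z.
have mX : measurable_fun setT X.
  apply: emeasurable_funM => //; apply/measurable_EFinP; apply: measurable_funM
    => //.
  by apply: (measurableT_comp (measurable_pospow b)); exact: measurable_snd.
have X0 z : 0 <= X z.
  apply: mule_ge0; last exact: F0.
  by rewrite lee_fin; exact: (mulr_ge0 c0 (pospow_ge0 _ _)).
pose G x := \int[mu]_u X (x, u).
have mG : measurable_fun setT G.
  exact: (@measurable_fun_fubini_tonelli_F _ _ mR mR R mu X mX X0).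
have G0 x : 0 <= G x by exact: integral_ge0.
transitivity (\int[mu]_x G x).
  apply: eq_integral => x _.
  exact: (ge0_integral_sqnorm k (section F x mF)).
rewrite (ge0_integral_sqrt mG G0); apply: eq_integral => v _.
have mX1 := section _ (Num.sqrt v) mX.
have mX2 := section _ (- Num.sqrt v)%R mX.
rewrite /G -(ge0_integralD mu measurableT _ mX1 _ mX2)//.
rewrite -ge0_integralZR ?divr_ge0 ?pospow_ge0//; last 2 first.
- exact: emeasurable_funD.
- by move=> x; apply: adde_ge0.
apply: eq_integral => r _; rewrite /X/= -ge0_muleDr// muleA -EFinM.
by congr (_%:E * _); ring.
Qed.

End lebesgue_tuple_integral.

(** * The law of the first coordinate on the sphere *)

Section sphere_integral.
Local Open Scope ereal_scope.
Context {R : realType}.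
Notation mu := (@lebesgue_measure R).
Notation mR := (measurableTypeR R).

(** The radial part of the volume of the cone. The signed square turns the half-integral power into
    the polynomial 2 x^k, which is integrated by its primitive. *)
Lemma integral_unit_pospow k :
  \int[mu]_w ((\1_(`]0%R, 1%R]%classic : set R) w)%:E * (pospow (k.+1%:R / 2)
    w)%:E) =
  (2 / k.+1%:R : R)%:E.
Proof.
have m1 : measurable_fun setT (\1_(`]0%R, 1%R]%classic : set R) : R -> R).
  by apply: measurable_indic; exact: measurable_itv.
rewrite ge0_integral_signed_square; last 2 first.
- apply: emeasurable_funM; apply/measurable_EFinP => //.
  exact: measurable_pospow.
- by move=> x; apply: mule_ge0; rewrite lee_fin ?pospow_ge0.
transitivity (\int[mu]_(x in `]0%R, 1%R]) (2 * x ^+ k)%:E).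
  rewrite [RHS]integral_mkcond; apply: eq_integral => x _; rewrite patchE.
  case: ifPn => [/set_mem/=|].
    rewrite in_itv/= => /andP[x0 x1]; rewrite gtr0_norm// pospow_gt0E
      ?mulr_gt0//.
    rewrite indicE mem_set ?mul1e; last first.
      by rewrite /= in_itv/= mulr_gt0// mulr_ile1// ltW.
    rewrite -EFinM; congr EFin; rewrite -expr2 -powR_mulrn ?ltW// -powRrM.
    rewrite mulrCA; congr (2 * _)%R.
    rewrite -[X in (_ * X)%R = _](powRr1 (ltW x0)) -powRD; last first.
      by rewrite (gt_eqF x0) implybT.
    by rewrite -powR_mulrn ?ltW//; congr (_ `^ _)%R; rewrite -natr1; field.
  rewrite notin_setE /= in_itv/= => xn.
  have [x0|x0] := leP x 0%R.
    by rewrite pospow_le0E ?mule0 ?mul0e// mulr_le0_ge0.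
  rewrite indicE memNset ?mul0e//= in_itv/= => /andP[_].
  rewrite gtr0_norm// => x1; apply: xn; rewrite x0/= leNgt; apply/negP => x1'.
  by move: x1; rewrite leNgt; move/negP; apply; rewrite -[X in (X < _)%R]mulr1
    ltr_pM.
rewrite integral_itv_obnd_cbnd; last first.
  by apply/measurable_EFinP; apply: measurable_funTS; apply: measurable_funM =>
    //; exact: measurable_funX.
rewrite (@continuous_FTC2 _ (fun x => 2 * x ^+ k)%R (fun x => 2 / k.+1%:R * x
  ^+ k.+1)%R)//.
- by rewrite expr1n mulr1 expr0n/= mulr0 oppr0 adde0.
- apply: continuous_subspaceT => x; apply: cvgM; first exact: cvg_cst.
  exact: exprn_continuous.
- split.
  + by move=> x _; apply: derivableM => //; exact: exprn_derivable.
  + apply: cvg_at_right_filter; apply: cvgM; first exact: cvg_cst.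
    exact: exprn_continuous.
  + apply: cvg_at_left_filter; apply: cvgM; first exact: cvg_cst.
    exact: exprn_continuous.
- move=> x _; rewrite derive1E.
  have [_ ->] : is_derive x (1 : R)%R (fun x : R => 2 / k.+1%:R * x ^+ k.+1)%R
    (2 / k.+1%:R * (k.+1%:R * x ^+ k))%R.
    rewrite (_ : (fun _ => _) = (2 / k.+1%:R)%R \*: (id ^+ k.+1)%R); last first.
      by apply/funext => y; rewrite /= fctE.
    have := is_deriveZ (2 / k.+1%:R)%R (is_deriveX k.+1 (is_derive_id x (1 :
      R)%R)).
    by rewrite /GRing.scale/= mulr1.
  by rewrite mulrA divfK// pnatr_eq0.
Qed.

(** The surface measure is a multiple of the image, under radial projection, of Lebesgue measure on
    the punctured ball; this projection lands on the sphere, so the complement of the sphere is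
    null. *)
Lemma ge0_integral_sphere_measure k (f : k.+1.-tuple mR -> \bar R) :
  measurable_fun setT f -> (forall t, 0 <= f t) ->
  \int[@sphere_measure R k]_(t in unit_sphere R k) f t =
  k.+1%:R%:E *
    \int[@lebesgue_tuple R k.+1]_(y in punctured_ball R k.+1) f (radial_proj y).
Proof.
move=> mf f0.
have mU : measurable (unit_sphere R k).
  rewrite (_ : unit_sphere R k = @enorm R k.+1 @^-1` [set 1%R])//.
  by rewrite -[X in measurable X]setTI; exact: measurable_enorm.
have mpb := @measurable_punctured_ball R k.+1.
have mrp := @measurable_radial_proj R k.+1.
have mfr : measurable_fun setT (f \o @radial_proj R k.+1) by exact:
  measurableT_comp.
have rp1 y : punctured_ball R k.+1 y -> unit_sphere R k (radial_proj y).
  rewrite /unit_sphere/= => y1.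
  have y0 : enorm y != 0%R by rewrite gt_eqF//; case/andP: y1.
  rewrite /enorm (eq_bigr (fun i => (enorm y)^-1 ^+ 2 * tnth y i ^+ 2)%R).
    rewrite -mulr_sumr sqrtrM ?sqr_ge0// sqrtr_sqr -[X in (_ * X)%R]/(enorm y).
    by rewrite ger0_norm ?invr_ge0 ?sqrtr_ge0// mulVf.
  by move=> i _; rewrite tnth_mktuple exprMn.
transitivity (\int[@sphere_measure R k]_t f t).
  rewrite integral_mkcond; apply: (eq_integral_off_null (N := ~` unit_sphere R
    k)).
  - exact: measurableC.
  - rewrite /= /sphere_measure (_ : _ `&` _ = set0) ?measure0 ?mule0//.
    by apply/seteqP; split => // y [/rp1].
  - by move=> y _ /contrapT yU; rewrite patchE mem_set.
rewrite -(@ge0_integral_mrestr _ _ _ (@lebesgue_tuple R k.+1) _ mpb _ mfr)//;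
  last by move=> y; exact: f0.
have -> : (k.+1%:R%:E : \bar R) = ((k.+1%:R : R)%:nng)%R%:num%:E by [].
rewrite -(@ge0_integral_scaled_pushforward _ _ _ _ _ _ _ mrp (@sphere_measure R
  k))//.
by move=> A mA; rewrite /= /sphere_measure /mrestr setIC.
Qed.

Lemma enorm_tcons k (x : mR) (y : k.-tuple mR) :
  enorm (tcons (x, y)) = Num.sqrt (x ^+ 2 + sqnorm y).
Proof. by rewrite /enorm -[X in Num.sqrt X]/(sqnorm _) sqnorm_tcons. Qed.

Lemma punctured_ball_tcons k (x : mR) (y : k.-tuple mR) :
  punctured_ball R k.+1 (tcons (x, y)) <-> (0 < x ^+ 2 + sqnorm y <= 1)%R.
Proof.
rewrite /punctured_ball/= enorm_tcons sqrtr_gt0.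
by rewrite -[X in (_ <= X)%R](sqrtr1 R) ler_sqrt ?sqrtr1.
Qed.

Lemma thead_radial_proj k (y : k.+1.-tuple mR) :
  thead (radial_proj y) = (thead y / enorm y)%R.
Proof. by rewrite /thead tnth_mktuple mulrC. Qed.

(** On the cone, with v = x^2 and u = |y|^2, the condition of lying in the ball concerns v + u
    alone, and the latitude is a signed root of v/(v + u). The two separate, and the radial factor
    cancels the dimension in the definition of the surface measure. *)
Lemma ge0_integral_sphere_thead k (g : R -> \bar R) :
  measurable_fun setT g -> (forall x, 0 <= g x) ->
  \int[@sphere_measure R k.+1]_(t in unit_sphere R k.+1) g (thead t) =
  \int[mu]_t ((2 * ball_density k * pospow (k.+1%:R / 2) (1 - t ^+ 2))%:E * g
    t).
Proof.
move=> mg g0; set b := (k.+1%:R / 2)%R.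
have mthead j : measurable_fun setT (fun t : j.+1.-tuple mR => thead t).
  exact: (measurable_tnth ord0).
have mgt : measurable_fun setT (fun t : k.+2.-tuple mR => g (thead t)).
  by apply: (measurableT_comp mg); exact: mthead.
rewrite ge0_integral_sphere_measure//.
pose p := (\1_(`]0%R, 1%R]%classic : set R) : R -> R).
have mp : measurable_fun setT p by apply: measurable_indic; exact:
  measurable_itv.
have mpE : measurable_fun setT (EFin \o p) by exact/measurable_EFinP.
pose s (v : R) := g (Num.sqrt v) + g (- Num.sqrt v)%R.
have msq : measurable_fun setT (@Num.sqrt R).
  by apply: continuous_measurable_fun; exact: sqrt_continuous.
have ms : measurable_fun setT s.
  apply: emeasurable_funD; first exact: (measurableT_comp mg).
  by apply: (measurableT_comp mg); exact: measurableT_comp.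
have s0 v : 0 <= s v by exact: adde_ge0.
pose F (z : R * R) := (p (z.1 ^+ 2 + z.2))%:E * g (z.1 / Num.sqrt (z.1 ^+ 2 +
  z.2))%R.
have m1 : measurable_fun setT (fst : R * R -> R) by exact: measurable_fst.
have m2 : measurable_fun setT (snd : R * R -> R) by exact: measurable_snd.
have mq : measurable_fun setT (fun z : R * R => z.1 ^+ 2 + z.2)%R.
  by apply: measurable_funD => //; exact: measurable_funX.
have mF : measurable_fun setT F.
  apply: emeasurable_funM; first exact: (measurableT_comp mpE mq).
  apply: (measurableT_comp mg); apply: measurable_funM => //.
  apply: (measurableT_comp (@measurable_fun_invr R)).
  exact: (measurableT_comp msq mq).
have F0 z : 0 <= F z by apply: mule_ge0 => //; rewrite lee_fin /p indicE.
have section (Z : R * R -> \bar R) u : measurable_fun setT Z ->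
    measurable_fun setT (fun r => Z (u, r)).
  by move=> mZ; apply: (measurableT_comp mZ); exact: measurable_fun_pair.
have pF (x : mR) (y : k.+1.-tuple mR) :
    ((fun t => g (thead (radial_proj t))) \_ (punctured_ball R k.+2)) (tcons
      (x, y)) = F (x, sqnorm y).
  rewrite patchE /F /p indicE /=; case: ifPn.
    move=> /set_mem/punctured_ball_tcons xy1.
    by rewrite mem_set ?mul1e /= ?in_itv//= thead_radial_proj enorm_tcons.
  rewrite notin_setE => nxy; rewrite memNset ?mul0e//= in_itv/=.
  by move=> xy; apply: nxy; apply/punctured_ball_tcons.
transitivity (k.+2%:R%:E * \int[mu]_x \int[@lebesgue_tuple R k.+1]_y F (x,
  sqnorm y)).
  congr (_ * _); rewrite integral_mkcond ge0_integral_lebesgue_tupleS.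
  - by apply: eq_integral => x _; apply: eq_integral => y _; rewrite pF.
  - apply/(measurable_restrictT _ _).1; first exact: measurable_punctured_ball.
    apply: measurable_funTS; apply: (measurableT_comp mgt).
    exact: measurable_radial_proj.
  - by move=> t; rewrite patchE; case: ifPn.
rewrite (ge0_integral_head_sqnorm k mF F0) -/b.
move: (@ball_density R k) (@ball_density_ge0 R k) => c c0.
have bE : b = (k.+1%:R / 2)%R by [].
clearbody b.
have p0 x : 0 <= (c / 2 * p x)%:E.
  rewrite lee_fin; apply: (mulr_ge0 (divr_ge0 c0 (ler0n _ 2))).
  by rewrite /p indicE.
have mcp : measurable_fun setT (fun x => (c / 2 * p x)%:E).
  by apply/measurable_EFinP; exact: measurable_funM.
(* From here u is the square of the first coordinate and r the squared norm of the others: [p] sees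
   only the sum, [s] only the ratio. *)
transitivity (k.+2%:R%:E * \int[mu]_u \int[mu]_r ((pospow 2^-1 u * pospow b
  r)%:E *
    ((c / 2 * p (u + r))%:E * s (u / (u + r))%R))).
  apply: (congr1 (fun z => k.+2%:R%:E * z)).
  apply: eq_integral => u _; apply: eq_integral => r _.
  have [u0|u0] := leP u 0%R; first by rewrite pospow_le0E// !(mul0r, mulr0,
    mul0e).
  have [r0|r0] := leP r 0%R; first by rewrite (pospow_le0E _ r0) !(mul0r,
    mulr0, mul0e).
  rewrite /F/= sqrrN sqr_sqrtr ?(ltW u0)// -ge0_muleDr// mulNr.
  rewrite -sqrtrV ?addr_ge0 ?ltW// -sqrtrM ?(ltW u0)//.
  by rewrite !muleA -!EFinM; congr (_%:E * _); ring.
rewrite (ge0_integral_pospow_polar 2^-1 b mcp p0 ms s0).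
rewrite (_ : 2^-1 + b = k.+2%:R / 2 :> R)%R; last first.
  by rewrite bE -[k.+2%:R]natr1; field.
transitivity (k.+2%:R%:E * ((c / 2)%:E * (2 / k.+2%:R)%:E *
    \int[mu]_v (s v * (pospow 2^-1 v * pospow b (1 - v))%:E))).
  rewrite -integral_unit_pospow -/p -ge0_integralZR; [|exact: (divr_ge0 c0
    (ler0n _ 2))| |].
  - congr (_ * (_ * _)); apply: eq_integral => w _.
    by rewrite muleA -EFinM.
  - by apply: emeasurable_funM => //; apply/measurable_EFinP; exact:
      measurable_pospow.
  - by move=> x; rewrite -EFinM lee_fin mulr_ge0 ?pospow_ge0// /p indicE.
rewrite !muleA -!EFinM.
have cE (r : R) : r != 0%R -> (r * (c / 2) * (2 / r) = c)%R by move=> r0; field.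
rewrite cE ?pnatr_eq0//.
(* The substitution v = t^2 is undone: [ge0_integral_sqrt] applied to the target gathers the two
   roots, and its 1/2 cancels the 2 in the density. *)
pose H (t : R) := (2 * c * pospow b (1 - t ^+ 2))%:E * g t.
have mH : measurable_fun setT H.
  apply: emeasurable_funM => //; apply/measurable_EFinP; apply: measurable_funM
    => //.
  apply: (measurableT_comp (measurable_pospow b)).
  by apply: measurable_funB => //; exact: measurable_funX.
have H0 t : 0 <= H t.
  apply: mule_ge0; last exact: g0.
  by rewrite lee_fin; exact: (mulr_ge0 (mulr_ge0 (ler0n _ 2) c0) (pospow_ge0 _
    _)).
rewrite -[RHS]/(\int[mu]_t H t) (ge0_integral_sqrt mH H0) -ge0_integralZR//;
  last 2 first.
- apply: emeasurable_funM => //; apply/measurable_EFinP; apply: measurable_funM.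
    exact: measurable_pospow.
  by apply: (measurableT_comp (measurable_pospow b)); exact: measurable_funB.
- by move=> x; apply: mule_ge0 => //; exact: epospow_mul_ge0.
apply: eq_integral => v _; rewrite /H /s.
have [v0|v0] := leP v 0%R.
  by rewrite pospow_le0E// !(mul0r, mulr0, mul0e, mule0).
rewrite sqrrN sqr_sqrtr ?(ltW v0)// -ge0_muleDr//.
by rewrite [X in _ * X = _]muleC !muleA -!EFinM; congr (_%:E * _); field.
Qed.

End sphere_integral.

(** * The transform J of a function of the height *)

(** A positive finite factor respects the convention for a difference of infinities, so signed
    integrals can be treated without integrability. *)
Lemma gt0_muleB (R : realType) (c : R) (x y : \bar R) : (0 < c)%R ->
  (c%:E * (x - y) = c%:E * x - c%:E * y)%E.
Proof.
move=> c0; have cE : (0 < c%:E)%E by rewrite lte_fin.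
case: x y => [x| |] [y| |];
  rewrite ?addeNy ?addNye ?addey ?addye ?gt0_muley ?gt0_muleNy ?oppe_inftyE//=.
by rewrite -EFinD -!EFinM -EFinD mulrBr.
Qed.

Lemma gt0_fineM (R : realType) (c : R) (x : \bar R) : (0 < c)%R ->
  fine (c%:E * x) = (c * fine x)%R.
Proof.
by move=> c0; case: x => [x| |]//=; rewrite ?gt0_muley ?gt0_muleNy ?lte_fin//=
  mulr0.
Qed.

Section sphere_height.
Local Open Scope ereal_scope.
Context {R : realType}.
Notation mu := (@lebesgue_measure R).
Notation mR := (measurableTypeR R).

(** Both exponents equal (k-1)/2. The first factor is the weight of the integrability hypothesis at
    dimension k+1, the second the Riemann-Liouville kernel of order (k+1)/2 with upper limit t. *)
Definition height_kernel k (t s : R) : R :=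
  (s `^ ((k.+1%:R - 2) / 2) * pospow (k.+1%:R / 2) (t - s))%R.

Lemma height_kernel_ge0 k t s : (0 <= height_kernel k t s)%R.
Proof. by rewrite mulr_ge0 ?powR_ge0 ?pospow_ge0. Qed.


(** With x = 1 + t one has 1 - t^2 = x (2 - x), and s = h x turns this into s (2h - s) / h^2. The
    vanishing of [H] on the nonpositive half-line takes the place of a cut-off in the power of s. *)
Lemma ge0_integral_sphere_height k (h : R) (H : R -> \bar R) : (0 < h)%R ->
  measurable_fun setT H -> (forall x, 0 <= H x) -> (forall x, (x <= 0)%R -> H x
    = 0) ->
  \int[@sphere_measure R k.+1]_(t in unit_sphere R k.+1) H (h * (1 + thead
    t))%R =
  (2 * ball_density k / h ^+ k)%:E *
  \int[mu]_s ((height_kernel k (2 * h) s)%:E * H s).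
Proof.
move=> h0 mH H0 Hle0.
have mHh : measurable_fun setT (fun t : R => H (h * (1 + t))%R).
  apply: (measurableT_comp mH); apply: measurable_funM => //.
  exact: measurable_funD.
rewrite (ge0_integral_sphere_thead k mHh)//.
move: (@ball_density R k) (@ball_density_ge0 R k) => c c0.
have bE : (k.+1%:R / 2 - 1 = (k.+1%:R - 2) / 2 :> R)%R by field.
rewrite /height_kernel; set b := (k.+1%:R / 2)%R in bE *.
have be := bE; have {}bE : b = (k.+1%:R / 2)%R by [].
clearbody b.
pose A (t : R) := (2 * c * pospow b (1 - t ^+ 2))%:E * H (h * (1 + t))%R.
have mA : measurable_fun setT A.
  apply: emeasurable_funM => //; apply/measurable_EFinP; apply: measurable_funM
    => //.
  apply: (measurableT_comp (measurable_pospow b)).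
  by apply: measurable_funB => //; exact: measurable_funX.
have A0 t : 0 <= A t.
  apply: mule_ge0; last exact: H0.
  by rewrite lee_fin; exact: (mulr_ge0 (mulr_ge0 (ler0n _ 2) c0) (pospow_ge0 _
    _)).
rewrite -[LHS]/(\int[mu]_t A t) -(ge0_integral_translate (-1) mA A0).
pose B (s : R) := (2 * c / h ^+ k * (s `^ ((k.+1%:R - 2) / 2) * pospow b (2 * h
  - s)))%:E * H s.
have mK : measurable_fun setT (fun s : R => s `^ ((k.+1%:R - 2) / 2) * pospow b
  (2 * h - s))%R.
  apply: measurable_funM; first exact: measurable_powR.
  by apply: (measurableT_comp (measurable_pospow _)); exact: measurable_funB.
have K0 s : (0 <= s `^ ((k.+1%:R - 2) / 2) * pospow b (2 * h - s))%R.
  by rewrite mulr_ge0 ?powR_ge0 ?pospow_ge0.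
have d0 : (0 <= 2 * c / h ^+ k)%R.
  by apply: divr_ge0; [exact: mulr_ge0|rewrite exprn_ge0// ltW].
have mB : measurable_fun setT B.
  by apply: emeasurable_funM => //; apply/measurable_EFinP; exact:
    measurable_funM.
have B0 s : 0 <= B s.
  by apply: mule_ge0; [rewrite lee_fin; exact: (mulr_ge0 d0 (K0 s))|exact: H0].
transitivity (\int[mu]_s B s); last first.
  rewrite -ge0_integralZR//; last 2 first.
  - by apply: emeasurable_funM => //; exact/measurable_EFinP.
  - by move=> s; apply: mule_ge0; [rewrite lee_fin; exact: K0|exact: H0].
  by apply: eq_integral => s _; rewrite /B EFinM muleA.
rewrite (ge0_integral_scale h0 mB B0) -ge0_integralZR ?(ltW h0)//; last first.
  by apply: (measurableT_comp mB); exact: measurable_funM.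
apply: eq_integral => x _; rewrite /A /B.
rewrite (_ : 1 + (x + -1) = x)%R; last by ring.
have [x0|x0] := leP x 0%R.
  by rewrite Hle0 ?mule0// pmulr_rle0.
rewrite muleA -EFinM; congr (_%:E * _).
rewrite (_ : 1 - (x + -1) ^+ 2 = x * (2 - x))%R; last by ring.
rewrite (_ : 2 * h - h * x = h * (2 - x))%R; last by ring.
rewrite !pospowZ// -!be powRM ?(ltW h0) ?(ltW x0)//.
(* The substitution costs h once and each of the two powers costs h^(b-1); altogether h^(2b-1) =
   h^k. *)
have hE : (h ^+ k = h * h `^ (b - 1) * h `^ (b - 1))%R.
  rewrite -[X in (X * _ * _)%R](powRr1 (ltW h0)) -!powRD ?(gt_eqF h0)
    ?implybT//.
  by rewrite -powR_mulrn ?(ltW h0)//; congr (_ `^ _)%R; rewrite bE -natr1;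
    field.
have hb0 : (h `^ (b - 1) != 0)%R by rewrite gt_eqF// powR_gt0.
by rewrite hE; field; rewrite hb0 gt_eqF.
Qed.

Lemma measurable_unit_sphere k : measurable (unit_sphere R k).
Proof.
rewrite (_ : unit_sphere R k = @enorm R k.+1 @^-1` [set 1%R])//.
by rewrite -[X in measurable X]setTI; exact: measurable_enorm.
Qed.

Lemma ball_density_gt0 k : (0 < @ball_density R k)%R.
Proof. by rewrite divr_gt0 ?powR_gt0 ?pi_gt0 ?Gamma_halfint_gt0. Qed.

Lemma integral_sphere_height k (h : R) (G : R -> R) : (0 < h)%R ->
  measurable_fun setT G -> (forall x, (x <= 0)%R -> G x = 0%R) ->
  \int[@sphere_measure R k.+1]_(t in unit_sphere R k.+1) (G (h * (1 + thead
    t)))%:E =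
  (2 * ball_density k / h ^+ k)%:E *
  \int[mu]_s (G s * height_kernel k (2 * h) s)%:E.
Proof.
move=> h0 mG Gle0; have mGE : measurable_fun setT (EFin \o G) by
  exact/measurable_EFinP.
rewrite integralE [X in _ = _ * X]integralE gt0_muleB; last first.
  by rewrite divr_gt0 ?exprn_gt0// mulr_gt0// ball_density_gt0.
congr (_ - _).
- transitivity (\int[@sphere_measure R k.+1]_(t in unit_sphere R k.+1)
      ((EFin \o G)^\+ (h * (1 + thead t))%R)).
    by apply: eq_integral => t _; rewrite !funeposE.
  rewrite ge0_integral_sphere_height//; last 2 first.
  + exact: measurable_funepos.
  + by move=> x x0; rewrite funeposE /= Gle0// maxxx.
  congr (_ * _); apply: eq_integral => s _; rewrite !funeposE /=.
  by rewrite maxe_pMr ?lee_fin ?height_kernel_ge0// mule0 -EFinM mulrC.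
- transitivity (\int[@sphere_measure R k.+1]_(t in unit_sphere R k.+1)
      ((EFin \o G)^\- (h * (1 + thead t))%R)).
    by apply: eq_integral => t _; rewrite !funenegE.
  rewrite ge0_integral_sphere_height//; last 2 first.
  + exact: measurable_funeneg.
  + by move=> x x0; rewrite funenegE /= Gle0// oppr0 maxxx.
  congr (_ * _); apply: eq_integral => s _; rewrite !funenegE /=.
  by rewrite maxe_pMr ?lee_fin ?height_kernel_ge0// mule0 -EFinM mulrN mulrC.
Qed.

Lemma lebesgue_measure_affine_preimage (N : set R) (h : R) : (0 < h)%R ->
  measurable N -> mu N = 0 -> mu [set t | N (h * (1 + t))%R] = 0.
Proof.
move=> h0 mN N0.
have mI : measurable_fun setT (fun x => (\1_N x)%:E : \bar R).
  by apply/measurable_EFinP; exact: measurable_indic.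
have mh : measurable_fun setT (fun t : R => h * (1 + t))%R.
  by apply: measurable_funM => //; exact: measurable_funD.
have mp : measurable [set t : R | N (h * (1 + t))%R].
  by rewrite -[X in measurable X]setTI; exact: mh.
have I0 x : 0 <= ((\1_N x)%:E : \bar R) by rewrite lee_fin indicE.
have mIh : measurable_fun setT (fun x : R => (\1_N (h * x))%:E : \bar R).
  by apply: (measurableT_comp mI); exact: measurable_funM.
have := ge0_integral_scale h0 mI I0.
have -> : \int[mu]_x (\1_N x)%:E = 0.
  by rewrite (@integral_indic _ mR R mu setT measurableT N mN) setIT.
move=> /esym/eqP.
rewrite mule_eq0 eqe (gt_eqF h0)/= => /eqP E.
transitivity (\int[mu]_t (\1_N (h * (t + 1)))%:E); last first.
  by rewrite (ge0_integral_translate 1 mIh).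
transitivity (\int[mu]_t (\1_([set t | N (h * (1 + t))%R]) t)%:E).
  by rewrite (@integral_indic _ mR R mu setT measurableT _ mp) setIT.
apply: eq_integral => t _.
by rewrite !indicE addrC; congr (_%:R%:E); apply/idP/idP; rewrite !inE.
Qed.

(** The latitude has a density, hence a null set of latitudes cuts out a set of area 0. This
    transfers an almost everywhere change of [f0] to the sphere. *)
Lemma negligible_sphere_thead k (M : set R) : measurable M -> mu M = 0 ->
  @sphere_measure R k.+1 ((fun t => thead t) @^-1` M `&` unit_sphere R k.+1) =
    0.
Proof.
move=> mM M0; have mU := @measurable_unit_sphere k.+1.
have mt : measurable_fun setT (fun t : k.+2.-tuple mR => thead t).
  exact: (measurable_tnth ord0).
have mP : measurable ((fun t : k.+2.-tuple mR => thead t) @^-1` M).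
  by rewrite -[X in measurable X]setTI; exact: mt.
have mI : measurable_fun setT (fun x => (\1_M x)%:E : \bar R).
  by apply/measurable_EFinP; exact: measurable_indic.
have := ge0_integral_sphere_thead k mI.
rewrite (_ : \int[_]_(t in _) _ = @sphere_measure R k.+1 ((fun t => thead t)
  @^-1` M `&` unit_sphere R k.+1)); last first.
  by rewrite -integral_indic.
move=> ->; last by move=> x; rewrite lee_fin.
rewrite (@eq_integral_off_null _ mR R mu setT M _ (cst 0))// ?integral0//.
by move=> x _ xM; rewrite indicE memNset// mule0.
Qed.

End sphere_height.

Section J_height.
Context {R : realType}.
Notation mu := (@lebesgue_measure R).
Notation mR := (measurableTypeR R).

Lemma height_sphere_param k d (x : 'rV[R]_(d + 1)) (xi : {vspace 'rV[R]_d})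
    (t : k.+1.-tuple mR) :
  height (x + height x *: sphere_param xi t) = height x * (1 + thead t).
Proof.
rewrite /height /sphere_param.
rewrite ![rsubmx _ 0 0]mxE [in LHS]mxE [X in _ + X]mxE row_mxEr mxE eqxx mulr1n.
by rewrite mulrDr mulr1.
Qed.

Lemma thead_unit_sphere k (t : k.+1.-tuple mR) : unit_sphere R k t -> -1 <=
  thead t.
Proof.
rewrite /unit_sphere/= => t1.
have : thead t ^+ 2 <= 1.
  have -> : 1 = \sum_(i < k.+1) tnth t i ^+ 2.
    have s0 : 0 <= \sum_(i < k.+1) tnth t i ^+ 2 by apply: sumr_ge0 => i _;
      exact: sqr_ge0.
    by rewrite -[RHS](sqr_sqrtr s0) -[X in X ^+ 2]/(enorm t) t1 expr1n.
  by rewrite big_ord_recl lerDl; apply: sumr_ge0 => i _; exact: sqr_ge0.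
by move=> ?; nra.
Qed.

Lemma J_heightE k d (f : 'rV[R]_(d + 1) -> R) (f0 g : R -> R) (N : set R) x xi :
  (forall y, half_space R d y -> f y = f0 (height y)) ->
  measurable_fun setT g -> measurable N -> mu N = 0%E ->
  (forall s, s <= 0 -> g s = 0) -> (forall s, 0 < s -> ~ N s -> f0 s = g s) ->
  half_space R d x ->
  J k.+1 f x xi = (sigma R k.+1)^-1 * (2 * ball_density k / height x ^+ k *
    \int[mu]_s (g s * height_kernel k (2 * height x) s)).
Proof.
move=> ff0 mg mN N0 g0 fg x0; rewrite /J; congr (_ * _).
have h0 : 0 < height x by exact: x0.
(* Latitudes to discard: those whose height falls into [N], and the pole -1, where the height is 0
   and [f0] does not determine [f]. *)
pose M := [set t : R | N (height x * (1 + t))] `|` [set -1].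
have mM1 : measurable [set t : R | N (height x * (1 + t))].
  have mh : measurable_fun setT (fun t : R => height x * (1 + t)).
    by apply: measurable_funM => //; exact: measurable_funD.
  by rewrite -[X in measurable X]setTI; exact: mh.
have mM : measurable M by apply: measurableU => //; exact: measurable_set1.
have M0 : mu M = 0%E.
  apply: null_set_setU => //; first exact: lebesgue_measure_affine_preimage.
  exact: lebesgue_measure_set1.
have E : (\int[@sphere_measure R k.+1]_(t in unit_sphere R k.+1)
     (f (x + height x *: sphere_param xi t))%:E =
   \int[@sphere_measure R k.+1]_(t in unit_sphere R k.+1)
     (g (height x * (1 + thead t)))%:E)%E; last first.
  rewrite /Rintegral E integral_sphere_height// gt0_fineM//.
  by rewrite divr_gt0 ?exprn_gt0// mulr_gt0// ball_density_gt0.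
apply: (eq_integral_off_null
  (N := (fun t : k.+2.-tuple mR => thead t) @^-1` M `&` unit_sphere R k.+1)).
- apply: measurableI; last exact: measurable_unit_sphere.
  have mt : measurable_fun setT (fun t : k.+2.-tuple mR => thead t).
    exact: (measurable_tnth ord0).
  by rewrite -[X in measurable X]setTI; exact: mt.
- exact: negligible_sphere_thead.
- move=> t t1 tM; have tN : ~ M (thead t) by move=> ?; exact: tM.
  have t0 : 0 < 1 + thead t.
    rewrite addrC -ltrBlDr sub0r lt_neqAle thead_unit_sphere// andbT.
    by apply/eqP => tE; apply: tN; right; rewrite /= -tE.
  have ht0 : 0 < height x * (1 + thead t) by exact: mulr_gt0.
  congr EFin; rewrite ff0 ?height_sphere_param//; last first.
    by rewrite /half_space/= height_sphere_param.
  by rewrite fg// => ?; apply: tN; left.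
Qed.

End J_height.

(** * Semigroup of the Riemann-Liouville integrals *)

Section rl.
Local Open Scope ereal_scope.
Context {R : realType}.
Notation mu := (@lebesgue_measure R).
Notation mR := (measurableTypeR R).
Implicit Types (a b x : R) (phi : R -> R).

(** The Riemann-Liouville integral as a convolution over the whole line, for functions that vanish
    on the nonpositive half-line. *)
Definition rl_conv a phi x := \int[mu]_y (phi y * pospow a (x - y))%:E.

Definition rl a phi x : R := ((Gamma a)^-1 * fine (rl_conv a phi x))%R.

Lemma measurable_fine : measurable_fun setT (@fine R).
Proof.
move=> _ B mB; rewrite setTI.
(* Since [fine] sends both infinities to 0, they belong to the preimage exactly when 0 lies in
   [B]. *)
rewrite (_ : _ @^-1` _ = EFin @` B `|` (if 0%R \in B then [set -oo; +oo] else
  set0)).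
  apply: measurableU; first exact: measurable_image_EFin.
  by case: ifPn => // _; apply: measurableU; exact: emeasurable_set1.
apply/seteqP; split=> [[r| |]|x]/=.
- by move=> Br; left; exists r.
- by move=> B0; right; rewrite mem_set//; right.
- by move=> B0; right; rewrite mem_set//; left.
- by move=> [[r Br <-]//|]; case: ifPn => // /set_mem B0 [->|->].
Qed.

Lemma measurable_rl_conv a phi : measurable_fun setT phi ->
  measurable_fun setT (rl_conv a phi).
Proof.
move=> mphi.
pose X (z : R * R) : \bar R := (phi z.2 * pospow a (z.1 - z.2))%:E.
have m1 : measurable_fun setT (fst : R * R -> R) by exact: measurable_fst.
have m2 : measurable_fun setT (snd : R * R -> R) by exact: measurable_snd.
have mX : measurable_fun setT X.
  apply/measurable_EFinP; apply: measurable_funM; first exact: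
    (measurableT_comp mphi m2).
  by apply: (measurableT_comp (measurable_pospow a)); exact: measurable_funB.
rewrite (_ : rl_conv a phi = fun x => \int[mu]_y X^\+ (x, y) - \int[mu]_y X^\-
  (x, y)); last first.
  by apply/funext => x; rewrite /rl_conv integralE; congr (_ - _); apply:
    eq_integral => y _;
    rewrite ?funeposE ?funenegE.
apply: emeasurable_funB.
- apply: (@measurable_integralR R (X^\+)); first exact: measurable_funepos.
  by move=> z; exact: funepos_ge0.
- apply: (@measurable_integralR R (X^\-)); first exact: measurable_funeneg.
  by move=> z; exact: funeneg_ge0.
Qed.


Lemma rl_le0 a phi x : (forall y, (y <= 0)%R -> phi y = 0%R) -> (x <= 0)%R ->
  rl a phi x = 0%R.
Proof.
move=> phi0 x0; rewrite /rl /rl_conv integral0_eq ?mulr0// => y _.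
have [y0|y0] := leP y 0%R; first by rewrite phi0// mul0r.
by rewrite pospow_le0E ?mulr0// subr_le0 (le_trans x0)// ltW.
Qed.

Lemma RL_integral_rl a (f g : R -> R) x : (forall y, (0 < y)%R -> f y = g y) ->
  (forall y, (y <= 0)%R -> g y = 0%R) -> RL_integral a f x = rl a g x.
Proof.
move=> fg g0; rewrite /RL_integral /rl /Rintegral; congr (_ * fine _)%R.
rewrite integral_mkcond; apply: eq_integral => y _; rewrite patchE; case: ifPn.
  rewrite inE/= in_itv/= => /andP[y0 yx].
  by rewrite fg// pospow_gt0E// subr_gt0.
rewrite notin_setE/= in_itv/= => /negP; rewrite negb_and -!leNgt => /orP[y0|xy].
  by rewrite g0// mul0r.
by rewrite pospow_le0E ?mulr0// subr_le0.
Qed.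

(** An infinite Beta value, multiplied by the positive Gamma(a + b), could not equal a product of
    two finite Gamma values. *)
Lemma ebeta_halfint_fin p q : ebeta (p.+1%:R / 2) (q.+1%:R / 2 : R) \is a
  fin_num.
Proof.
have := egammaM (p.+1%:R / 2) (q.+1%:R / 2 : R).
have -> : (p.+1%:R / 2 + q.+1%:R / 2 = (p + q).+1.+1%:R / 2 :> R)%R.
  by rewrite -mulrDl -natrD addSn addnS.
rewrite !egamma_halfint => E.
rewrite ge0_fin_numE ?ltW ?ebeta_gt0// ltey; apply/eqP => boo.
by move: E; rewrite boo gt0_muley ?lte_fin ?Gamma_halfint_gt0// -EFinM.
Qed.

Lemma ge0_integral_pospow_conv_shift a b (x s : R) :
  \int[mu]_y (pospow a (y - s) * pospow b (x - y))%:E =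
  (pospow (a + b) (x - s))%:E * ebeta a b.
Proof.
have m1 : measurable_fun setT (cst 1 : R -> \bar R) by exact: measurable_cst.
have := ge0_integral_pospow_conv a b (x - s) m1 (fun=> lee01).
have mH := measurable_pospow_conv a b (x - s) m1.
have H0 u : 0 <= (cst 1 (u / (x - s))%R : \bar R) * (pospow a u * pospow b (x -
  s - u))%:E.
  by apply: mule_ge0 => //; exact: epospow_mul_ge0.
rewrite -(ge0_integral_translate (- s) mH H0) => E.
transitivity (\int[mu]_y (cst 1 ((y + - s) / (x - s))%R * (pospow a (y + - s) *
  pospow b (x - s - (y + - s)))%:E)).
  apply: eq_integral => y _; rewrite mul1e; congr (_ * pospow b _)%:E; ring.
by rewrite E; congr (_ * _); apply: eq_integral => v _; rewrite mul1e.
Qed.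

Section semigroup.
Variables (phi : R -> R) (p q : nat) (x : R).
Hypothesis mphi : measurable_fun setT phi.
Let a : R := (p.+1%:R / 2)%R.
Let b : R := (q.+1%:R / 2)%R.
Hypothesis phi_fin : \int[mu]_s (`|phi s| * pospow (a + b) (x - s))%:E < +oo.

Let B := fine (ebeta a b).
Let BE : ebeta a b = B%:E. Proof. by rewrite /B fineK// ebeta_halfint_fin. Qed.
Let B0 : (0 < B)%R. Proof. by rewrite -lte_fin -BE ebeta_gt0. Qed.

Let X (z : R * R) : \bar R := (phi z.2 * (pospow a (z.1 - z.2) * pospow b (x -
  z.1)))%:E.

Let mX : measurable_fun setT X.
Proof.
have m1 : measurable_fun setT (fst : R * R -> R) by exact: measurable_fst.
have m2 : measurable_fun setT (snd : R * R -> R) by exact: measurable_snd.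
apply/measurable_EFinP; apply: measurable_funM; first exact: (measurableT_comp
  mphi m2).
apply: measurable_funM.
  by apply: (measurableT_comp (measurable_pospow a)); exact: measurable_funB.
by apply: (measurableT_comp (measurable_pospow b)); exact: measurable_funB.
Qed.

Let w s y : \bar R := (pospow a (y - s) * pospow b (x - y))%:E.

Let mw s : measurable_fun setT (w s).
Proof.
apply/measurable_EFinP; apply: measurable_funM.
  by apply: (measurableT_comp (measurable_pospow a)); exact: measurable_funB.
by apply: (measurableT_comp (measurable_pospow b)); exact: measurable_funB.
Qed.

Let w0 s y : 0 <= w s y. Proof. exact: epospow_mul_ge0. Qed.

Let wE s : \int[mu]_y w s y = (pospow (a + b) (x - s) * B)%:E.
Proof. by rewrite /w ge0_integral_pospow_conv_shift BE. Qed.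

Let mconv : measurable_fun setT (fun s : R => pospow (a + b) (x - s))%R.
Proof. by apply: (measurableT_comp (measurable_pospow _)); exact:
  measurable_funB. Qed.

(** Integrated first in y, the absolute value of [X] gives a Beta constant times the integrand of
    [phi_fin]. *)
Let iX : (mu \x mu).-integrable setT (X : mR * mR -> \bar R).
Proof.
apply/(@integrable21ltyP _ _ mR mR R mu mu X mX).
rewrite (_ : \int[mu]_s _ = B%:E * \int[mu]_s (`|phi s| * pospow (a + b) (x -
  s))%:E).
  by rewrite lte_mul_pinfty// lee_fin ltW.
rewrite -ge0_integralZR ?(ltW B0)//; last 2 first.
- apply/measurable_EFinP; apply: measurable_funM => //.
  exact: measurableT_comp.
- by move=> s; rewrite lee_fin mulr_ge0 ?pospow_ge0.
apply: eq_integral => s _.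
transitivity (\int[mu]_y (`|phi s|%:E * w s y)).
  apply: eq_integral => y _; rewrite /X/= normrM EFinM; congr (_ * _%:E).
  by rewrite ger0_norm// -lee_fin; exact: w0.
by rewrite ge0_integralZR//; rewrite wE -!EFinM; congr EFin; ring.
Qed.

Let iw s : mu.-integrable setT (w s).
Proof.
apply/integrableP; split; first exact: mw.
under eq_integral do rewrite gee0_abs//.
by rewrite wE ltry.
Qed.

Let XE2 s : \int[mu]_y X (y, s) = (B * (phi s * pospow (a + b) (x - s)))%:E.
Proof.
transitivity (\int[mu]_y ((phi s)%:E * w s y)); first by [].
by rewrite integralZl// wE -EFinM; congr EFin; ring.
Qed.

Let iconv : mu.-integrable setT (fun s : R => (phi s * pospow (a + b) (x -
  s))%:E).
Proof.
apply/integrableP; split.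
  by apply/measurable_EFinP; exact: measurable_funM.
under eq_integral do rewrite /= normrM (ger0_norm (pospow_ge0 _ _)).
exact: phi_fin.
Qed.

(** For y < x the outer kernel is positive and can be divided out, so integrability of the section
    makes [rl_conv] finite at y. For y >= x both sides are 0, whatever [rl_conv] is there. *)
Let XE1 y : mu.-integrable setT (fun s : R => X (y, s)) ->
  \int[mu]_s X (y, s) = (fine (rl_conv a phi y) * pospow b (x - y))%:E.
Proof.
move=> iXy; have [xy|xy] := leP (x - y)%R 0%R.
  rewrite [in RHS](pospow_le0E _ xy) mulr0; apply: integral0_eq => s _.
  by rewrite /X/= (pospow_le0E _ xy) !mulr0.
have p0 := pospow_gt0 b xy.
have i1 : mu.-integrable setT (fun s : R => (phi s * pospow a (y - s))%:E).
  have := integrableZl measurableT (pospow b (x - y))^-1 iXy.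
  apply: eq_integrable => // s _.
  by rewrite /X/= -EFinM; congr EFin; field; rewrite gt_eqF.
transitivity (\int[mu]_s ((pospow b (x - y))%:E * (phi s * pospow a (y -
  s))%:E)).
  by apply: eq_integral => s _; rewrite /X/= -EFinM; congr EFin; ring.
rewrite integralZl//.
have ifin : rl_conv a phi y \is a fin_num by exact: integrable_fin_num.
by rewrite -[X in _ * X]/(rl_conv a phi y) -(fineK ifin) -EFinM mulrC.
Qed.

Let aeX : {ae mu, forall y, \int[mu]_s X (y, s) = (fine (rl_conv a phi y) *
  pospow b (x - y))%:E}.
Proof.
have := @ae_integrable1 _ _ mR mR R mu mu X iX.
by apply: filterS => y; exact: XE1.
Qed.

Let integrable_rl_conv :
  mu.-integrable setT (fun y : R => (fine (rl_conv a phi y) * pospow b (x -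
    y))%:E).
Proof.
have /integrableP[_ iF] := @integrable_fubini_F _ _ mR mR R mu mu X iX.
apply/integrableP; split.
  apply/measurable_EFinP; apply: measurable_funM.
    apply: (measurableT_comp _ (measurable_rl_conv a mphi)); exact:
      measurable_fine.
  by apply: (measurableT_comp (measurable_pospow b)); exact: measurable_funB.
have [N [mN N0 XN]] := aeX.
rewrite (@eq_integral_off_null _ mR R mu setT N _ (fun y => `|\int[mu]_s X (y,
  s)|))//.
by move=> y _ yN; congr (`|_|); apply/esym; apply: contrapT => Xy; apply: yN;
  exact: XN.
Qed.

Let integral_rl_conv :
  \int[mu]_y (fine (rl_conv a phi y) * pospow b (x - y))%:E = B%:E * rl_conv (a
    + b) phi x.
Proof.
have [N [mN N0 XN]] := aeX.
rewrite (@eq_integral_off_null _ mR R mu setT N _ (fun y => \int[mu]_s X (y,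
  s)))//; last first.
  by move=> y _ yN; apply/esym; apply: contrapT => Xy; apply: yN; exact: XN.
rewrite (@Fubini _ _ mR mR R mu mu X iX).
under eq_integral do rewrite XE2 EFinM.
by rewrite integralZl.
Qed.

Lemma integrable_rl : mu.-integrable setT (fun y : R => (rl a phi y * pospow b
  (x - y))%:E).
Proof.
have := integrableZl measurableT (Gamma a)^-1 integrable_rl_conv.
by apply: eq_integrable => // y _; rewrite /rl -EFinM mulrA.
Qed.

Lemma rl_semigroup : rl b (rl a phi) x = rl (a + b) phi x.
Proof.
have aE : a = (p.+1%:R / 2)%R by []; have bE : b = (q.+1%:R / 2)%R by [].
have Ga : (0 < Gamma a)%R by exact: Gamma_halfint_gt0.
have Gb : (0 < Gamma b)%R by exact: Gamma_halfint_gt0.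
have abE : (a + b = (p + q).+1.+1%:R / 2 :> R)%R.
  by rewrite aE bE -mulrDl -natrD addSn addnS.
have Gab : (0 < Gamma (a + b))%R by rewrite abE Gamma_halfint_gt0.
have ga : egamma a = (Gamma a)%:E by exact: egamma_halfint.
have gb : egamma b = (Gamma b)%:E by exact: egamma_halfint.
have gab : egamma (a + b) = (Gamma (a + b))%:E by rewrite abE egamma_halfint.
have := egammaM a b; rewrite BE ga gb gab -!EFinM => -[GE].
rewrite /rl {1}/rl_conv.
under eq_integral do rewrite -mulrA EFinM.
rewrite integralZl// integral_rl_conv.
rewrite -[rl_conv (a + b) phi x]fineK; last exact: integrable_fin_num.
rewrite -!EFinM/=.
have -> : (B = Gamma a * Gamma b / Gamma (a + b))%R by rewrite GE mulrC mulKf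
  ?gt_eqF.
by field; rewrite !gt_eqF.
Qed.

End semigroup.

End rl.

(** * Derivatives of the iterated integrals *)

Section rl_derivatives.
Context {R : realType}.
Notation mu := (@lebesgue_measure R).
Notation mR := (measurableTypeR R).
Variable phi : R -> R.
Hypothesis mphi : measurable_fun setT phi.
Hypothesis phi0 : forall y, y <= 0 -> phi y = 0.
Hypothesis iphi : forall a : R, 0 < a -> (\int[mu]_(s in `]0%R, a[) `|phi s|%:E
  < +oo)%E.

(** For c >= 1 the kernel on (0, x) is at most x^(c-1), so local integrability of [phi] suffices at
    every x. *)
Lemma rl_abs_fin (c x : R) : 1 <= c ->
  (\int[mu]_s (`|phi s| * pospow c (x - s))%:E < +oo)%E.
Proof.
move=> c1; have [x0|x0] := leP x 0.
  rewrite integral0_eq// => s _; have [s0|s0] := leP s 0.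
    by rewrite phi0// normr0 mul0r.
  by rewrite pospow_le0E ?mulr0// subr_le0 (le_trans x0)// ltW.
have mn : measurable_fun setT (fun s => `|phi s|) by exact: measurableT_comp.
have mI : measurable (`]0, x[ : set R) by exact: measurable_itv.
have mr : measurable_fun setT ((fun s => `|phi s|%:E) \_ (`]0%R, x[ : set R)).
  apply/(measurable_restrictT _ _).1 => //; apply: measurable_funTS.
  exact/measurable_EFinP.
have mL : measurable_fun setT (fun s : R => (`|phi s| * pospow c (x - s))%:E).
  apply/measurable_EFinP; apply: measurable_funM => //.
  by apply: (measurableT_comp (measurable_pospow c)); exact: measurable_funB.
have mRr : measurable_fun setT
    (fun s : R => (x `^ (c - 1))%:E * ((fun s => `|phi s|%:E) \_ (`]0%R, x[ :
      set R)) s)%E.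
  exact: emeasurable_funM.
apply: (@le_lt_trans _ _ (\int[mu]_s ((x `^ (c - 1))%:E * ((fun s => `|phi
  s|%:E) \_ `]0%R, x[) s))%E).
  apply: ge0_le_integral => //.
  - by move=> s _; rewrite lee_fin mulr_ge0 ?pospow_ge0.
  - move=> s _; rewrite patchE; case: ifPn.
      rewrite inE/= in_itv/= => /andP[s0 sx].
      rewrite -EFinM lee_fin mulrC ler_wpM2r// pospow_gt0E ?subr_gt0//.
      apply: ge0_ler_powR; rewrite ?subr_ge0// ?nnegrE ?subr_ge0 ?(ltW sx)
        ?(ltW x0)//.
      by rewrite lerBlDr lerDl ltW.
    rewrite notin_setE/= in_itv/= => /negP; rewrite negb_and -!leNgt mule0 =>
      /orP[s0|xs].
      by rewrite phi0// normr0 mul0r.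
    by rewrite pospow_le0E ?mulr0// subr_le0.
rewrite ge0_integralZR ?powR_ge0//; last first.
  by move=> s; rewrite patchE; case: ifPn; rewrite ?lee_fin.
by rewrite -integral_mkcond lte_mul_pinfty ?lee_fin ?powR_ge0// iphi.
Qed.

Lemma rl1E (psi : R -> R) x : rl 1 psi x = \int[mu]_(y in `]-oo, x]) psi y.
Proof.
rewrite /rl Gamma1 invr1 mul1r /rl_conv /Rintegral; congr fine.
rewrite [RHS]integral_mkcond.
(* The integrands differ only at y = x, since [pospow 1] is 0 at 0. *)
apply: (@eq_integral_off_null _ mR R mu setT [set x]).
- exact: measurable_set1.
- exact: lebesgue_measure_set1.
move=> y _ yx; rewrite patchE; case: ifPn.
  rewrite inE/= in_itv/= le_eqVlt => /predU1P[//|xy].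
  by rewrite pospow1 ?mulr1// subr_gt0.
rewrite notin_setE/= in_itv/= => /negP; rewrite -ltNge => xy.
by rewrite pospow_le0E ?mulr0// subr_le0 ltW.
Qed.

Lemma rlS j x : rl j.+2%:R phi x = rl 1 (rl j.+1%:R phi) x.
Proof.
(* Integers are written as half-integers, the form in which the semigroup law was proved. *)
have jE : j.+1%:R = (j.*2.+1).+1%:R / 2 :> R.
  by rewrite -doubleS -muln2 natrM mulfK.
have oE : 1 = 2%:R / 2 :> R by rewrite divff.
rewrite jE [X in rl X (rl _ _)]oE rl_semigroup//.
  by rewrite -jE -oE natr1.
by rewrite -jE -oE natr1; apply: rl_abs_fin; rewrite ler1n.
Qed.

Lemma integrable_rlNy j u : mu.-integrable `]-oo, u] (EFin \o rl j.+1%:R phi).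
Proof.
have jE : j.+1%:R = (j.*2.+1).+1%:R / 2 :> R.
  by rewrite -doubleS -muln2 natrM mulfK.
have oE : 1 = 2%:R / 2 :> R by rewrite divff.
(* The upper limit u + 1 keeps every y <= u strictly below it, where the kernel of order 1 equals
   1. *)
have := @integrable_rl R phi j.*2.+1 1 (u + 1) mphi.
rewrite -jE -oE natr1 => /(_ (rl_abs_fin _ _)) i.
have {}i : mu.-integrable setT (fun y : R => (rl j.+1%:R phi y * pospow 1 (u +
  1 - y))%:E).
  by apply: i; rewrite ler1n.
have mI : measurable (`]-oo, u] : set mR) by exact: measurable_itv.
have := integrableS measurableT mI (subsetT _) i.
apply: eq_integrable => // y; rewrite inE/= in_itv/= => yu.
by rewrite pospow1 ?mulr1// subr_gt0 (le_lt_trans yu)// ltrDl.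
Qed.

Lemma integrable_phiNy u : mu.-integrable `]-oo, u] (EFin \o phi).
Proof.
have mI : measurable (`]-oo, u] : set mR) by exact: measurable_itv.
apply/integrableP; split; first by apply/measurable_EFinP; exact:
  measurable_funTS.
have mL : measurable_fun setT (fun s : R => (`|phi s| * pospow 1 (u + 1 -
  s))%:E).
  apply/measurable_EFinP; apply: measurable_funM; first exact: measurableT_comp.
  by apply: (measurableT_comp (measurable_pospow _)); exact: measurable_funB.
have mA : measurable_fun setT ((abse \o (EFin \o phi)) \_ (`]-oo, u] : set R)).
  apply/(measurable_restrictT _ _).1; first exact: measurable_itv.
  apply: measurable_funTS; apply: measurableT_comp => //.
  exact/measurable_EFinP.
apply: le_lt_trans (@rl_abs_fin 1 (u + 1) (lexx _)).
rewrite integral_mkcond; apply: ge0_le_integral => //.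
- by move=> y _; rewrite patchE; case: ifPn.
- move=> y _; rewrite patchE; case: ifPn; last by rewrite lee_fin mulr_ge0
    ?pospow_ge0.
  rewrite inE/= in_itv/= => yu.
  by rewrite pospow1 ?mulr1// subr_gt0 (le_lt_trans yu)// ltrDl.
Qed.

Lemma locally_integrable_phi : locally_integrable [set: R] phi.
Proof.
split => //; first exact: openT.
move=> K _ cK; have [M [Mreal MK]] := compact_bounded cK.
have mn : measurable_fun setT (fun y : R => `|phi y|%:E).
  by apply/measurable_EFinP; exact: measurableT_comp.
have /integrableP[_] := integrable_phiNy (M + 1).
apply: le_lt_trans; apply: ge0_subset_integral => //.
- by apply: compact_measurable.
- exact: (measurable_funTS mn).
- move=> y Ky; rewrite /= in_itv/=.
  have /(_ _ y Ky) := MK (M + 1); rewrite ltrDl ltr01 => /(_ isT).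
  by apply: le_trans; exact: ler_norm.
Qed.

Lemma ae_derivable_rl1 :
  {ae mu, forall x, derivable (rl 1 phi) x 1 /\ derive1 (rl 1 phi) x = phi x}.
Proof.
rewrite (_ : rl 1 phi = fun x => \int[mu]_(y in `]-oo, x]) phi y); last first.
  by apply/funext => x; rewrite rl1E.
apply: FTC1Ny; first exact: integrable_phiNy.
exact: locally_integrable_phi.
Qed.

(** As [phi] vanishes on the nonpositive half-line, the integral from -1 equals the integral from
    minus infinity at every point beyond -1, and continuity of an indefinite integral on a compact
    interval applies. *)
Lemma continuous_rl1 x : 0 < x -> {for x, continuous (rl 1 phi)}.
Proof.
move=> x0; pose G y := parameterized_integral mu (-1) y phi.
have ab : -1 < x + 1 by rewrite (@lt_trans _ _ 0)// ?ltrN10// addr_gt0.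
have iab : mu.-integrable `[-1, x + 1] (EFin \o phi).
  apply: integrableS (integrable_phiNy (x + 1)) => //.
  by apply: subset_itvr.
have := parameterized_integral_continuous (ltW ab) iab.
move/(continuous_within_itvP _ ab) => [cG _ _].
have : {for x, continuous G}.
  by apply: cG; rewrite in_itv/= ltrDl ltr01 andbT (lt_trans _ x0)// ltrN10.
have GE y : -1 < y -> G y = rl 1 phi y.
  move=> y1; rewrite rl1E /G /parameterized_integral Rintegral_mkcond
    [RHS]Rintegral_mkcond.
  congr Rintegral; apply/funext => s; rewrite !patchE !mem_setE !in_itv/=.
  have [s1|s1] := leP (-1) s => //=.
  by case: ifPn => //; rewrite phi0// (le_trans (ltW s1))// lerN10.
move=> cGx; have {}cGx : G y @[y --> x] --> rl 1 phi x.
  by rewrite -GE// (lt_trans _ x0)// ltrN10.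
apply: cvg_trans cGx; apply: near_eq_cvg; near=> y; apply: GE.
by near: y; apply: lt_nbhsr; rewrite (lt_trans _ x0)// ltrN10.
Unshelve. all: by end_near. Qed.

(** The fundamental theorem wants a continuous integrand: at the first step this is
    [continuous_rl1], afterwards it follows from the differentiability just proved. *)
Lemma derivable_rlS j x : 0 < x ->
  derivable (rl j.+2%:R phi) x 1 /\ derive1 (rl j.+2%:R phi) x = rl j.+1%:R phi
    x.
Proof.
elim: j x => [|j IH] x x0.
  rewrite (_ : rl 2 phi = fun x => \int[mu]_(y in `]-oo, x]) rl 1 phi y); last
    first.
    by apply/funext => y; rewrite (rlS 0) rl1E.
  apply: (@continuous_FTC1 R (rl 1 phi) -oo%O x (x + 1)) => //.
  - by rewrite ltrDl.
  - exact: (integrable_rlNy 0).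
  - by rewrite ltNyr.
  - exact: continuous_rl1.
rewrite (_ : rl j.+3%:R phi = fun x => \int[mu]_(y in `]-oo, x]) rl j.+2%:R phi
  y); last first.
  by apply/funext => y; rewrite rlS rl1E.
apply: (@continuous_FTC1 R (rl j.+2%:R phi) -oo%O x (x + 1)) => //.
- by rewrite ltrDl.
- exact: integrable_rlNy.
- by rewrite ltNyr.
- have [d _] := IH x x0.
  by apply: differentiable_continuous; exact/derivable1_diffP.
Qed.

Section iterated.
Variables (m : nat) (g : R -> R).
Hypothesis gE : forall x, 0 < x -> g x = rl m.+1%:R phi x.

(** Differentiation is local, so agreement of [g] with the iterated integral on the open half-line
    is enough. *)
Lemma derive1n_rl j x : (j <= m)%N -> 0 < x -> derive1n j g x = rl (m -
  j).+1%:R phi x.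
Proof.
elim: j x => [|j IH] x jm x0; first by rewrite subn0 derive1n0 gE.
rewrite derive1nS derive1E.
rewrite (@near_eq_derive _ _ _ _ (rl (m - j).+1%:R phi)); last first.
  by near=> y; apply: IH; [exact: ltnW|near: y; exact: lt_nbhsr].
by rewrite -derive1E -(subnSK jm); have [_ ->] := derivable_rlS (m - j.+1) x0.
Unshelve. all: by end_near. Qed.

Lemma derivableS_rl x : 0 < x -> derivable (rl 1 phi) x 1 -> derive1 (rl 1 phi)
  x = phi x ->
  derivableS_at m g x /\ derive1n m.+1 g x = phi x.
Proof.
move=> x0 d1 d1E.
have near0 : \forall y \near x, derive1n m g y = rl 1 phi y.
  near=> y; rewrite derive1n_rl ?subnn//.
  by near: y; exact: lt_nbhsr.
split; last by rewrite derive1nS derive1E (near_eq_derive _ near0) -derive1E.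
split; last first.
  apply: near_eq_derivable d1.
  by near=> y; apply/esym; near: y.
move=> j jm; near=> t; have t0 : 0 < t by near: t; exact: lt_nbhsr.
have [i iE] : exists i, (m - j = i.+1)%N.
  by exists (m - j).-1; rewrite prednK// subn_gt0.
have [d _] := derivable_rlS i t0.
apply: near_eq_derivable d; near=> y.
rewrite derive1n_rl ?iE// 1?ltnW//.
by near: y; exact: lt_nbhsr.
Unshelve. all: by end_near. Qed.

End iterated.
End rl_derivatives.

(** * Inversion *)

Lemma exists_height {R : realType} d (h : R) : exists x : 'rV[R]_(d + 1),
  height x = h.
Proof.
exists (row_mx 0 h%:M); rewrite /height mxE row_mxEr mxE eqxx mulr1n//.
Qed.

(** A plane of each dimension up to d exists; this makes the relation between J and [Phi] determine
    [Phi] at positive heights. *)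
Lemma grassmannian_neq0 (R : realType) k d : (k <= d)%N ->
  exists xi, grassmannian R k d xi.
Proof.
move=> kd; pose X := vbasis (fullv : {vspace 'rV[R]_d}).
have sX : size X = d by rewrite size_tuple dimvf /dim/= mul1n.
have fX : free (take k X ++ drop k X) by rewrite cat_take_drop; exact:
  basis_free (vbasisP _).
exists <<take k X>>%VS; rewrite /grassmannian/=.
by have /eqP-> := catl_free fX; rewrite size_take_min sX; apply/minn_idPl.
Qed.

(** The order 1 - alpha_0 belonging to alpha = k/2 is 1 or 1/2, again a positive half-integer, and
    added to k/2 it gives m + 1. *)
Lemma truncn_half_complement (R : realType) k :
  exists q, 1 - (k%:R / 2 - (Num.truncn (k%:R / 2 : R))%:R) = q.+1%:R / 2 :> R
    /\
    q.+1%:R / 2 + k%:R / 2 = (Num.truncn (k%:R / 2 : R)).+1%:R :> R.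
Proof.
set m := Num.truncn _; have k0 : 0 <= k%:R / 2 :> R by rewrite divr_ge0.
have : k%:R / 2 < m.+1%:R :> R by exact: truncnS_gt.
rewrite ltr_pdivrMr// -natrM ltr_nat muln2 => km.
(* The numerator q + 1 is 2 (m + 1) - k, positive because k/2 < m + 1. *)
exists (m.+1.*2 - k).-1; rewrite prednK ?subn_gt0//.
rewrite natrB ?(ltnW km)// -muln2 natrM -natr1.
by split; field.
Qed.

Section inversion.
Context {R : realType}.
Notation mu := (@lebesgue_measure R).
Variables (k d : nat) (f : 'rV[R]_(d + 1) -> R) (f0 g : R -> R) (N : set R).
Hypothesis kd : (k < d)%N.
Hypothesis ff0 : forall y, half_space R d y -> f y = f0 (height y).
Hypotheses (mg : measurable_fun setT g) (mN : measurable N) (N0 : mu N = 0%E).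
Hypothesis g0 : forall s, s <= 0 -> g s = 0.
Hypothesis fg : forall s, 0 < s -> ~ N s -> f0 s = g s.
Hypothesis f0_fin : forall a : R, 0 < a ->
  (\int[mu]_(s in `]0%R, a[) (`|f0 s| * s `^ ((k.+1%:R - 2) / 2))%:E < +oo)%E.

Let phi s := g s * s `^ ((k.+1%:R - 2) / 2).

Let mphi : measurable_fun setT phi.
Proof. by apply: measurable_funM => //; exact: measurable_powR. Qed.

Let phi0 s : s <= 0 -> phi s = 0.
Proof. by move=> s0; rewrite /phi g0// mul0r. Qed.

Let iphi a : 0 < a -> (\int[mu]_(s in `]0%R, a[) `|phi s|%:E < +oo)%E.
Proof.
move=> a0; apply: le_lt_trans (f0_fin a0).
rewrite (@eq_integral_off_null _ (measurableTypeR R) R mu _ N _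
  (fun s => (`|f0 s| * s `^ ((k.+1%:R - 2) / 2))%:E))//.
move=> s; rewrite /= in_itv/= => /andP[s0 _] Ns.
by rewrite /phi normrM fg// (ger0_norm (powR_ge0 _ _)).
Qed.

Definition height_transform (h : R) : R :=
  (sigma R k.+1)^-1 * (2 * ball_density k / h ^+ k *
    \int[mu]_s (g s * height_kernel k (2 * h) s)).

Lemma J_height_transform x xi : half_space R d x ->
  J k.+1 f x xi = height_transform (height x).
Proof. exact: (J_heightE k xi ff0 mg mN N0 g0 fg). Qed.

Variable Phi : R -> R.
Hypothesis PhiE : forall x xi, half_space R d x -> grassmannian R k.+1 d xi ->
  J k.+1 f x xi = Phi (height x).

Let F (t : R) := pi `^ 2^-1 / Gamma (k.+2%:R / 2) * (t / 2) ^+ k * Phi (t / 2).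

Lemma Phi_height_transform h : 0 < h -> Phi h = height_transform h.
Proof.
move=> h0; have [x hx] := @exists_height R d h.
have [xi dxi] := @grassmannian_neq0 R k.+1 d kd.
have x0 : half_space R d x by rewrite /half_space/= hx.
by rewrite -hx -(PhiE x0 dxi) J_height_transform.
Qed.

(** The normalisation of F is made for this: its constant, 1/[sigma] and the constant of the
    latitude density multiply to 1/Gamma((k+1)/2), and the powers of h = t/2 cancel. *)
Lemma F_rl t : 0 < t -> F t = rl (k.+1%:R / 2) phi t.
Proof.
move=> t0; have h0 : 0 < t / 2 by rewrite divr_gt0.
rewrite /F Phi_height_transform// /height_transform.
rewrite (_ : 2 * (t / 2) = t); last by field.
rewrite /rl (_ : fine (rl_conv _ _ _) = \int[mu]_s (g s * height_kernel k t
  s)); last first.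
  congr fine; apply: eq_integral => s _.
  by rewrite /phi /height_kernel mulrA.
move: (\int[mu]_s _) => I.
rewrite /sigma /ball_density.
have -> : pi `^ (k.+2%:R / 2) = pi `^ 2^-1 * pi `^ (k.+1%:R / 2) :> R.
  rewrite -powRD ?(gt_eqF (pi_gt0 R)) ?implybT//; congr (_ `^ _).
  by rewrite -[k.+2%:R]natr1; field.
have p1 : (pi : R) `^ 2^-1 != 0 by rewrite gt_eqF// powR_gt0// pi_gt0.
have p2 : (pi : R) `^ (k.+1%:R / 2) != 0 by rewrite gt_eqF// powR_gt0// pi_gt0.
have g1 : Gamma (k.+1%:R / 2 : R) != 0 by rewrite gt_eqF// Gamma_halfint_gt0.
have g2 : Gamma (k.+2%:R / 2 : R) != 0 by rewrite gt_eqF// Gamma_halfint_gt0.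
have hk : (t / 2) ^+ k != 0 by rewrite expf_neq0// gt_eqF.
move: (Gamma _) (Gamma _) ((t / 2) ^+ k) (pi `^ _) (pi `^ _) p1 p2 g1 g2 hk =>
  G2 G1 H P1 P2 p1 p2 g1 g2 hk.
by field; rewrite p1 p2 g1 g2 hk.
Qed.

(** The orders add up to m + 1 >= 1, for which [rl_abs_fin] provides the finiteness that the
    semigroup law asks for. *)
Lemma RL_primitive_rl x :
  RL_primitive (k.+1%:R / 2) F x = rl (Num.truncn (k.+1%:R / 2 : R)).+1%:R phi
    x.
Proof.
have [q [qE qkE]] := truncn_half_complement R k.+1.
rewrite /RL_primitive qE (@RL_integral_rl R _ _ (rl (k.+1%:R / 2) phi)) //.
- rewrite rl_semigroup//; first by rewrite addrC qkE.
  rewrite addrC qkE; apply: (rl_abs_fin mphi phi0 iphi).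
  by rewrite ler1n.
- by move=> y y0; exact: F_rl.
- by move=> y y0; exact: rl_le0.
Qed.

Lemma ae_RL_inversion : {ae mu, forall s, 0 < s ->
  RL_derivable (k.+1%:R / 2) F s /\
  f0 s = s `^ ((2 - k.+1%:R) / 2) * RL_derivative (k.+1%:R / 2) F s}.
Proof.
have aeN : {ae mu, forall s, ~ N s}.
  by exists N; split => // s /=; exact: contrapT.
have := ae_derivable_rl1 mphi phi0 iphi; move: aeN.
apply: filterS2; first exact: (ae_filter_ringOfSetsType mu).
move=> s Ns [d1 d1E] s0.
have gE x : 0 < x -> RL_primitive (k.+1%:R / 2) F x =
    rl (Num.truncn (k.+1%:R / 2 : R)).+1%:R phi x by move=> _; exact:
      RL_primitive_rl.
have [dS dE] := derivableS_rl mphi phi0 iphi gE s0 d1 d1E.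
split; first exact: dS.
rewrite /RL_derivative dE /phi fg// mulrCA -powRD ?(gt_eqF s0) ?implybT//.
rewrite (_ : (2 - k.+1%:R) / 2 + (k.+1%:R - 2) / 2 = 0) ?powRr0 ?mulr1//.
by field.
Qed.

Lemma ae_injective (a : R) : 0 < a ->
  (forall x xi, half_space R d x -> height x < a ->
     grassmannian R k.+1 d xi -> J k.+1 f x xi = 0) ->
  {ae mu, forall s, forall y, half_space R d y -> height y = s -> s < a -> f y
    = 0}.
Proof.
move=> a0 J0; move: ae_RL_inversion.
apply: filterS; first exact: (ae_filter_ringOfSetsType mu).
move=> s + y y0 ys sa.
have s0 : 0 < s by rewrite -ys.
move=> /(_ s0)[_ f0E]; rewrite ff0// ys f0E.
have Phi0 h : 0 < h -> h < a -> Phi h = 0.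
  move=> h0 ha; have [x hx] := @exists_height R d h.
  have [xi dxi] := @grassmannian_neq0 R k.+1 d kd.
  have x0 : half_space R d x by rewrite /half_space/= hx.
  by rewrite -hx -(PhiE x0 dxi) J0// hx.
(* F at t involves [Phi] at t/2, and t/2 < t < a. *)
have F0 t : 0 < t -> t < a -> F t = 0.
  move=> t0 ta; rewrite /F Phi0 ?mulr0 ?divr_gt0//.
  by rewrite ltr_pdivrMr// (lt_trans ta)// ltr_pMr// ltr1n.
(* The primitive at x depends on F on (0, x) only, hence vanishes on the open half-line below a; so
   do all its derivatives there. *)
have P0 j x : x < a -> derive1n j (RL_primitive (k.+1%:R / 2) F) x = 0.
  elim: j x => [|j IH] x xa.
    rewrite derive1n0 /RL_primitive /RL_integral /Rintegral integral0_eq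
      ?mulr0//.
    move=> t; rewrite /= in_itv/= => /andP[t0 tx].
    by rewrite F0 ?mul0r// (lt_trans tx).
  rewrite derive1nS derive1E (@near_eq_derive _ _ _ _ (cst 0)) ?derive_cst//.
  by near=> z; apply: IH; near: z; exact: lt_nbhsl.
by rewrite /RL_derivative P0// mulr0.
Unshelve. all: by end_near. Qed.

End inversion.

Theorem theorem7p2 (R : realType) (n k : nat) (hk : (1 <= k <= n - 1)%N)
    (f : 'rV[R]_(n - 1 + 1) -> R) (f0 : R -> R)
    (hf0 : lebesgue_measurable_fun `]0, +oo[ f0)
    (hf : forall y, half_space R (n - 1) y -> f y = f0 (height y))
    (hint : forall a : R, 0 < a ->
      (\int[@lebesgue_measure R]_(s in `]0%R, a[)
         (`|f0 s| * s `^ ((k%:R - 2) / 2))%:E < +oo)%E) :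
  let is_Phi (Phi : R -> R) := forall x xi, half_space R (n - 1) x ->
    grassmannian R k (n - 1) xi -> J k f x xi = Phi (height x) in
  [/\ exists Phi : R -> R, is_Phi Phi,
      forall Phi : R -> R, is_Phi Phi ->
        let F (t : R) := pi `^ 2^-1 / Gamma (k.+1%:R / 2) *
                           (t / 2) ^+ k.-1 * Phi (t / 2) in
        {ae @lebesgue_measure R, forall s, 0 < s ->
           RL_derivable (k%:R / 2) F s /\
           f0 s = s `^ ((2 - k%:R) / 2) * RL_derivative (k%:R / 2) F s} &
      forall a : R, 0 < a ->
        (forall x xi, half_space R (n - 1) x -> height x < a ->
           grassmannian R k (n - 1) xi -> J k f x xi = 0) ->
        {ae @lebesgue_measure R, forall s, forall y,
           half_space R (n - 1) y -> height y = s -> s < a -> f y = 0}].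
Proof.
(* The dimension is at least 1 and is written as a successor, so that the exponent [k.-1] in F
   becomes the new k. *)
case: k hk hint => [|k]; first by rewrite ltnn.
move=> /andP[_ kn] hint is_Phi.
have mI : measurable (`]0, +oo[ : set R) by exact: measurable_itv.
have [g [N [mg mN N0 g0 fg]]] := lebesgue_measurable_fun_borel mI hf0.
have {}g0 s : s <= 0 -> g s = 0.
  by move=> s0; apply: g0; rewrite /= in_itv/= andbT; apply/negP; rewrite -leNgt.
have {}fg s : 0 < s -> ~ N s -> f0 s = g s.
  by move=> s0; apply: fg; rewrite /= in_itv/= s0.
have hPhi : is_Phi (height_transform k g).
  by move=> x xi x0 _; exact: (J_height_transform k hf mg mN N0 g0 fg xi x0).
split; first by exists (height_transform k g).
- move=> Phi PhiE F.
  exact: (ae_RL_inversion kn hf mg mN N0 g0 fg hint PhiE).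
(* The vanishing of J is tested through the function of the height supplied by [hPhi]. *)
- move=> a a0; exact: (ae_injective kn hf mg mN N0 g0 fg hint hPhi a0).
Qed.
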